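(* Let $0<p<1$ and let $U$ be a depth-$d$ circuit of two-qubit gates on $n$ qubits, used as an encoding of $k$ logical qubits. Suppose that its Choi error $\epsilon=\epsilon_{\mathrm{Choi}}$ against the strength-$p$ local depolarizing channel satisfies $\epsilon<0.1$. Then: 1. If $U$ is a $D$-dimensional circuit, then $$(2d)^D\log\Big(\frac1p\Big)+2D\log(2d)\ge\log\Big(\frac3{8\epsilon_{\mathrm{Choi}}^2}\Big)+\log k .$$ In the limit of large $n$ and $d$ this implies $$d\ge\frac12\left[\frac{\log\big(\frac3{8\epsilon^2}\big)+\log k}{(1+o(1))\log\big(\frac1p\big)}\right]^{1/D}.$$ 2. If $U$ is an all-to-all circuit, then $$2^d\log\Big(\frac1p\Big)+2d\ge\log\Big(\frac3{8\epsilon_{\mathrm{Choi}}^2}\Big)+\log k .$$ In the limit of large $n$ and $d$ this implies $$d\ge\log\left[\frac{\log\big(\frac3{8\epsilon^2}\big)+\log k}{(1+o(1))\log\big(\frac1p\big)}\right].$$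
   Context: All logarithms are base 2. The $o(1)$ terms tend to $0$ as $d\to\infty$ (with $p$, $D$ fixed). Circuit of depth $d$: $U=\prod_{i=1}^d\big(\bigotimes_jV_{i,j}\big)$, each layer consisting of two-qubit gates with disjoint supports. In a $D$-dimensional circuit the qubits sit on a $D$-dimensional square lattice and gates act on nearest-neighbour pairs; in an all-to-all circuit gates may act on arbitrary pairs. Encoding and Choi error: $L$ is a system of $k$ logical qubits, $S$ the $n$-qubit physical system ($L$ together with $n-k$ ancillas initialized in $|0\rangle$), $R$ a $k$-qubit reference, $\hat\phi_{LR}$ the maximally entangled state. The encoding is $\mathcal E(\rho)=U(\rho\otimes|0^{n-k}\rangle\langle0^{n-k}|)U^\dagger$. For a noise channel $\mathcal N$ on $S$, $$\epsilon_{\mathrm{Choi}}=\min_{\mathcal D}P\big(\hat\phi_{LR},[(\mathcal D\circ\mathcal N\circ\mathcal E)_L\otimes I_R](\hat\phi_{LR})\big),$$ the minimum being over all quantum channels $\mathcal D$ from $S$ to $L$, where $P(\rho,\sigma)=\sqrt{1-F(\rho,\sigma)^2}$ and $F(\rho,\sigma)=\Vert\sqrt\rho\sqrt\sigma\Vert_1$. The strength-$p$ local depolarizing channel is $\mathcal N=\mathcal N_d^{\otimes n}$ with single-qubit channel $\mathcal N_d(\rho)=(1-p)\rho+p\,\mathbb I/2$. *)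

(* Defs.v *)
From HB Require Import structures.
From mathcomp Require Import all_boot all_order all_algebra.
From mathcomp Require Import complex.
From mathcomp Require Import all_classical all_reals all_analysis.

Set Implicit Arguments.
Unset Strict Implicit.
Unset Printing Implicit Defensive.

Import Order.TTheory GRing.Theory Num.Theory.
Import numFieldNormedType.Exports.

Local Open Scope ring_scope.
Local Open Scope sesquilinear_scope.

(* Operators on the Hilbert space with orthonormal basis [T] are square matrices
   of size [#|T|], the basis vectors being numbered by [enum_rank]; the tensor
   product of the spaces over [A] and [B] is the space over [A * B]. *)
Notation op R T := 'M[R[i]]_#|{: T}|.

Section Operators.
Context {R : realType}.
Implicit Types A B T : finType.

Definition opE T (M : op R T) (x y : T) : R[i] :=
  M (enum_rank x) (enum_rank y).

Definition mkop T (f : T -> T -> R[i]) : op R T :=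
  \matrix_(i, j) f (enum_val i) (enum_val j).

Definition psdmx n (M : 'M[R[i]]_n) : Prop :=
  M \is hermsymmx /\ forall v : 'rV_n, 0 <= (v *m M *m v ^t*) 0 0.

(* Square root by functional calculus, from M = P^-1 diag(s) P with P unitary;
   meaningful for positive semidefinite M. *)
Definition sqrtmx n (M : 'M[R[i]]_n) : 'M[R[i]]_n :=
  invmx (spectralmx M) *m diag_mx (map_mx sqrtC (spectral_diag M))
    *m spectralmx M.

(* The trace of |M| = sqrt (M^dagger M) is real, so [Re] only changes its type. *)
Definition trace_norm n (M : 'M[R[i]]_n) : R :=
  complex.Re (\tr (sqrtmx (M ^t* *m M))).

Definition fidelity n (rho sigma : 'M[R[i]]_n) : R :=
  trace_norm (sqrtmx rho *m sqrtmx sigma).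

Definition purified_distance n (rho sigma : 'M[R[i]]_n) : R :=
  Num.sqrt (1 - fidelity rho sigma ^+ 2).

(* [ampliation T Phi] is Phi (x) id_T: Phi is applied to each block <t| X |t'>. *)
Definition ampliation A B T (Phi : op R A -> op R B) (X : op R (A * T)%type)
    : op R (B * T)%type :=
  mkop (fun u v => opE
    (Phi (mkop (fun a a' => opE X (a, u.2) (a', v.2)))) u.1 v.1).

Definition quantum_channel A B (Phi : {linear op R A -> op R B}) : Prop :=
  (forall T (X : op R (A * T)%type), psdmx X -> psdmx (ampliation Phi X)) /\
  (forall X, \tr (Phi X) = \tr X).

End Operators.

Definition qubits (n : nat) : finType := {ffun 'I_n -> bool}.

Section Circuits.
Context {R : realType}.
Variable n : nat.

Record gate := Gate {
  gate_fst : 'I_n;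
  gate_snd : 'I_n;
  gate_op : op R (bool * bool) }.

Definition gate_supp (g : gate) : seq 'I_n := [:: gate_fst g; gate_snd g].

Definition gate_mx (g : gate) : op R (qubits n) :=
  mkop (fun x y : qubits n =>
    opE (gate_op g) (x (gate_fst g), x (gate_snd g))
                    (y (gate_fst g), y (gate_snd g))
    * [forall (i | i \notin gate_supp g), x i == y i]%:R).

(* [E] is the set of pairs on which gates may act. The [uniq] condition says both
   that each gate acts on two distinct qubits and that the supports of the gates
   of a layer are disjoint. *)
Definition is_layer (E : rel 'I_n) (l : seq gate) : bool :=
  [&& uniq (flatten (map gate_supp l)),
      all (fun g => gate_op g \is unitarymx) l
    & all (fun g => E (gate_fst g) (gate_snd g)) l].

(* The supports being disjoint, this product is the tensor product of the gates
   (and of the identity on idle qubits), in whatever order it is taken. *)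
Definition layer_mx (l : seq gate) : op R (qubits n) :=
  foldr (fun g M => gate_mx g *m M) 1%:M l.

Definition circuit_mx (c : seq (seq gate)) : op R (qubits n) :=
  foldr (fun l M => layer_mx l *m M) 1%:M c.

Definition is_circuit (E : rel 'I_n) (d : nat) (U : op R (qubits n)) : Prop :=
  exists c : seq (seq gate),
    [/\ size c = d, all (is_layer E) c & U = circuit_mx c].

Definition all_to_all_circuit (d : nat) (U : op R (qubits n)) : Prop :=
  is_circuit (fun _ _ => true) d U.

Definition nearest_neighbours D (u v : {ffun 'I_D -> int}) : bool :=
  (\sum_(j < D) `|u j - v j|%N)%N == 1%N.

(* The qubits occupy distinct sites of the lattice Z^D. *)
Definition lattice_circuit (D d : nat) (U : op R (qubits n)) : Prop :=
  exists2 pos : 'I_n -> {ffun 'I_D -> int}, injective pos &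
    is_circuit (fun a b => nearest_neighbours (pos a) (pos b)) d U.

End Circuits.

Section Codes.
Context {R : realType}.

(* The trace makes the single-qubit channel rho |-> (1 - p) rho + p I/2 linear. *)
Definition depolarizing (p : R) (X : op R bool) : op R bool :=
  (1 - p)%:C%C *: X + (p%:C%C * \tr X / 2) *: 1%:M.

(* The n-fold tensor power of the linear map Phi, which sends |a><b| to the
   tensor product of the Phi(|a_i><b_i|). *)
Definition tensor_power n (Phi : op R bool -> op R bool) (X : op R (qubits n))
    : op R (qubits n) :=
  mkop (fun x y : qubits n =>
    \sum_(a : qubits n) \sum_(b : qubits n) opE X a b *
      \prod_(i < n)
        opE (Phi (delta_mx (enum_rank (a i)) (enum_rank (b i)))) (x i) (y i)).

Variables (n k : nat) (hkn : (k <= n)%N).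

Definition logical_part (x : qubits n) : qubits k :=
  [ffun i => x (widen_ord hkn i)].

Definition ancillas_zero (x : qubits n) : bool :=
  [forall (i : 'I_n | (k <= i)%N), ~~ x i].

(* rho (x) |0..0><0..0|, the first k of the n qubits being the logical ones. *)
Definition add_ancillas (rho : op R (qubits k)) : op R (qubits n) :=
  mkop (fun x y : qubits n =>
    opE rho (logical_part x) (logical_part y)
    * (ancillas_zero x && ancillas_zero y)%:R).

Definition encoding (U : op R (qubits n)) (rho : op R (qubits k))
    : op R (qubits n) :=
  U *m add_ancillas rho *m U ^t*.

Definition max_entangled : op R (qubits k * qubits k)%type :=
  mkop (fun u v => ((u.1 == u.2) && (v.1 == v.2))%:R / (2 ^ k)%:R).

(* The set of decoders is compact, so that the infimum is a minimum. *)
Definition choi_error (U : op R (qubits n))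
    (N : op R (qubits n) -> op R (qubits n)) : R :=
  inf [set e : R |
    exists2 Dec : {linear op R (qubits n) -> op R (qubits k)},
      quantum_channel Dec &
      e = purified_distance max_entangled
            (ampliation (Dec \o N \o encoding U) max_entangled)]%classic.

End Codes.

Definition log2 {R : realType} (x : R) : R := ln x / ln 2.

(* Main.v *)
(* Replace every noisy qubit by its erasure: the noise erases each set T of qubits
   with probability p^|T| (1-p)^(n-|T|). If T contains the forward light cone of
   the logical qubit j, then the Pauli operators of j are mapped by U to operators
   supported on erased qubits, so the erased state does not change when a Pauli
   operator is applied to the j-th reference qubit. After any decoding this
   reference qubit is thus maximally mixed and uncorrelated with the rest, which
   leaves a squared fidelity of at most 1/4 with the maximally entangled state.
   Light cones, forward and backward, have at most L qubits, with L = (2d)^D or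
   L = 2^d, so at least m = k/L^2 logical qubits have pairwise disjoint cones. The
   probability that none of these cones is erased is at most
   (1 - p^L)^m <= 1/(1 + m p^L), hence eps^2 >= (3/4) m p^L / (1 + m p^L). As
   eps < 1/10, this gives 8 eps^2 L^2 >= 3 k p^L. *)
Require Import Defs.
From HB Require Import structures.
From mathcomp Require Import all_boot all_order all_algebra.
From mathcomp Require Import complex.
From mathcomp Require Import all_classical all_reals all_analysis.
From mathcomp Require Import ring lra zify.

Set Implicit Arguments.
Unset Strict Implicit.
Unset Printing Implicit Defensive.

Import Order.TTheory GRing.Theory Num.Theory.
Import numFieldNormedType.Exports.

Local Open Scope ring_scope.
Local Open Scope sesquilinear_scope.

(** * Spectral calculus and the fidelity with a pure state *)

(** An erased qubit is replaced by the maximally mixed state, with no flag telling where, so the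
    depolarizing noise is exactly a mixture of the maps [erase T]. As the maximally entangled state
    is pure, the squared fidelity with it is linear in the decoded state, and a bound for each [T]
    averages to a bound for the noise. The value 1/4 is a product of two halves: invariance under Z
    kills the blocks whose reference bits differ, and invariance under X spreads the remaining
    weight over two orthogonal diagonals. The factor L^2 is the price of independence: a cone has at
    most L qubits and each of them lies in at most L cones, so a logical qubit conflicts with at
    most L^2 logical qubits, itself included. Since eps < 1/10 forces m p^L < 1, the denominator 1 +
    m p^L costs at most a factor 2, which turns 3/4 into 3/8. *)

Section Spectral.
Context {C : numClosedFieldType}.

Lemma adjmx_mul m n p (A : 'M[C]_(m, n)) (B : 'M[C]_(n, p)) :
  (A *m B) ^t* = B ^t* *m A ^t*.
Proof. by rewrite trmx_mul map_mxM. Qed.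

Lemma unitarymx_adjmul n (U : 'M[C]_n) : U \is unitarymx -> U ^t* *m U = 1%:M.
Proof. by move/unitarymxP/mulmx1C. Qed.

(** Squaring the sum of roots kills the cross terms. It applies to the spectrum of a rank-one
    matrix, where at most one eigenvalue is nonzero. *)
Lemma sum_sqrtC_orthogonal n (s : 'I_n -> C) :
  (forall i, 0 <= s i) -> (forall i j, i != j -> s i * s j = 0) ->
  (\sum_i sqrtC (s i)) = sqrtC (\sum_i s i).
Proof.
move=> s0 sij; have S0 : 0 <= \sum_i sqrtC (s i).
  by apply: sumr_ge0 => i _; rewrite sqrtC_ge0.
rewrite -[LHS]sqrCK //; congr sqrtC.
rewrite expr2 mulr_suml; apply: eq_bigr => i _.
rewrite mulr_sumr (bigD1 i) //= -expr2 sqrtCK big1 ?addr0 // => j ji.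
by rewrite -sqrtCM ?qualifE ?s0 //= sij ?sqrtC0 // eq_sym.
Qed.

Lemma unitarymx_conj_mul n (P D E : 'M[C]_n) : P \is unitarymx ->
  (P ^t* *m D *m P) *m (P ^t* *m E *m P) = P ^t* *m (D *m E) *m P.
Proof.
by move=> /unitarymxP P1; rewrite !mulmxA -(mulmxA _ P (P ^t*)) P1 mulmx1.
Qed.

Lemma unitarymx_conjK n (P D : 'M[C]_n) : P \is unitarymx ->
  P *m (P ^t* *m D *m P) *m P ^t* = D.
Proof.
by move=> /unitarymxP P1; rewrite !mulmxA P1 mul1mx -mulmxA P1 mulmx1.
Qed.

Lemma unitarymx_conj_conj n (U P X : 'M[C]_n) : U \is unitarymx ->
  let W := U *m P *m U ^t* in
  W *m (U *m X *m U ^t*) *m W ^t* = U *m (P *m X *m P ^t*) *m U ^t*.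
Proof.
move=> /unitarymx_adjmul U1 W; rewrite /W !adjmx_mul trmxCK !mulmxA.
by rewrite -(mulmxA _ (U ^t*) U) U1 mulmx1 -(mulmxA _ (U ^t*) U) U1 mulmx1.
Qed.

Lemma unitarymx_conj n (U P : 'M[C]_n) : U \is unitarymx -> P \is unitarymx ->
  U *m P *m U ^t* \is unitarymx.
Proof. by move=> Uu Pu; rewrite !mul_unitarymx // trmxC_unitary. Qed.

Lemma unitarymx_diag_sqrtC n (P : 'M[C]_n) (s : 'rV[C]_n) :
  P \is unitarymx -> (forall i, 0 <= s 0 i) ->
  let Q := P ^t* *m diag_mx (map_mx sqrtC s) *m P in
  Q *m Q ^t* = P ^t* *m diag_mx s *m P.
Proof.
move=> Pu s0 Q; rewrite /Q !adjmx_mul trmxCK (mulmxA (P ^t*) _ P).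
rewrite unitarymx_conj_mul // tr_diag_mx map_diag_mx mulmx_diag.
congr (_ *m diag_mx _ *m _).
by apply/rowP => i; rewrite !mxE /= geC0_conj ?sqrtC_ge0 // -expr2 sqrtCK.
Qed.

(** The eigenvalues of an idempotent are 0 and 1, which the square root fixes. *)
Lemma unitarymx_diag_sqrtC_idem n (P : 'M[C]_n) (s : 'rV[C]_n) :
  P \is unitarymx ->
  let M := P ^t* *m diag_mx s *m P in
  M *m M = M -> P ^t* *m diag_mx (map_mx sqrtC s) *m P = M.
Proof.
move=> Pu M; rewrite unitarymx_conj_mul // => idM.
congr (_ *m diag_mx _ *m _); apply/rowP => i; rewrite mxE.
have /matrixP/(_ i i) : diag_mx s *m diag_mx s = diag_mx s.
  by rewrite -[LHS](unitarymx_conjK _ Pu) idM unitarymx_conjK.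
rewrite mulmx_diag !mxE eqxx !mulr1n => /eqP.
rewrite -subr_eq0 -{3}[s 0 i]mulr1 -mulrBr mulf_eq0 subr_eq0.
by case/orP => /eqP ->; rewrite ?sqrtC0 ?sqrtC1.
Qed.

Lemma unitarymx_diag_sqrtC_rank1 n (P : 'M[C]_n) (s a : 'rV[C]_n) :
  P \is unitarymx -> (forall i, 0 <= s 0 i) ->
  a ^t* *m a = P ^t* *m diag_mx s *m P ->
  \tr (P ^t* *m diag_mx (map_mx sqrtC s) *m P) = sqrtC ((a *m a ^t*) 0 0).
Proof.
move=> Pu s0 aE.
have trE (t : 'rV[C]_n) : \tr (P ^t* *m diag_mx t *m P) = \sum_i t 0 i.
  rewrite mxtrace_mulC mulmxA.
  by have /unitarymxP -> := Pu; rewrite mul1mx mxtrace_diag.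
have -> : (a *m a ^t*) 0 0 = \sum_i s 0 i.
  by rewrite -trE -aE mxtrace_mulC /mxtrace big_ord1.
rewrite trE -sum_sqrtC_orthogonal //; first by apply: eq_bigr => i _; rewrite mxE.
(* In the eigenbasis the rank-one matrix has entries conj(u_i) u_j. Being diagonal, it has conj(u_i)
   u_j = 0 off the diagonal, hence s_i s_j = |u_i|^2 |u_j|^2 = 0. *)
set u := a *m P ^t*.
have entry i j : (diag_mx s) i j = (u 0 i)^* * u 0 j.
  rewrite -[diag_mx s](unitarymx_conjK _ Pu) -aE mulmxA -mulmxA.
  by rewrite -{1}[P]trmxCK -adjmx_mul mxE big_ord1 !mxE.
have diagE i : s 0 i = (u 0 i)^* * u 0 i by rewrite -entry mxE eqxx mulr1n.
move=> i j ij; have := entry i j.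
rewrite mxE (negPf ij) mulr0n => /esym uij.
by rewrite !diagE mulrACA [u 0 i * _]mulrC mulrACA uij mul0r.
Qed.

End Spectral.

Section Fidelity.
Context {R : realType}.
Local Notation C := R[i].

Lemma psdmx_spectral n (M : 'M[C]_n) : psdmx M ->
  M = (spectralmx M) ^t* *m diag_mx (spectral_diag M) *m spectralmx M.
Proof.
case=> /hermitian_normalmx/orthomx_spectralP ME _; rewrite {1}ME.
by rewrite invmx_unitary // spectral_unitarymx.
Qed.

Lemma spectral_diag_ge0 n (M : 'M[C]_n) : psdmx M ->
  forall i, 0 <= spectral_diag M 0 i.
Proof.
move=> psdM i.
have := unitarymx_conjK (diag_mx (spectral_diag M)) (spectral_unitarymx M).
rewrite -psdmx_spectral // => /matrixP/(_ i i).
rewrite [RHS]mxE eqxx mulr1n => <-.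
have [_ /(_ (row i (spectralmx M)))] := psdM.
rewrite -row_mul !mxE; under eq_bigr do rewrite !mxE.
by under [X in _ -> _ <= X]eq_bigr do rewrite !mxE.
Qed.

Lemma sqrtmxE n (M : 'M[C]_n) : sqrtmx M =
  (spectralmx M) ^t* *m diag_mx (map_mx sqrtC (spectral_diag M)) *m spectralmx M.
Proof. by rewrite /sqrtmx invmx_unitary // spectral_unitarymx. Qed.

Lemma sqrtmx_mul_adj n (M : 'M[C]_n) : psdmx M -> sqrtmx M *m (sqrtmx M) ^t* = M.
Proof.
move=> psdM; rewrite [RHS](psdmx_spectral psdM) sqrtmxE.
exact: unitarymx_diag_sqrtC (spectral_unitarymx M) (spectral_diag_ge0 psdM).
Qed.

Lemma sqrtmx_idem n (M : 'M[C]_n) : psdmx M -> M *m M = M -> sqrtmx M = M.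
Proof.
move=> psdM idM; rewrite [RHS](psdmx_spectral psdM) sqrtmxE.
apply: (unitarymx_diag_sqrtC_idem (spectral_unitarymx M)).
by rewrite -psdmx_spectral.
Qed.

Lemma psdmx_gram m n (A : 'M[C]_(m, n)) : psdmx (A ^t* *m A).
Proof.
split; first by apply/is_hermitianmxP; rewrite expr0 scale1r adjmx_mul trmxCK.
move=> v; rewrite mulmxA -mulmxA.
have -> : A *m v ^t* = (v *m A ^t*) ^t* by rewrite adjmx_mul trmxCK.
by rewrite mxE; apply: sumr_ge0 => i _; rewrite !mxE mul_conjC_ge0.
Qed.

Lemma tr_sqrtmx_rank1 n (a : 'rV[C]_n) :
  \tr (sqrtmx (a ^t* *m a)) = sqrtC ((a *m a ^t*) 0 0).
Proof.
have psda := psdmx_gram a; rewrite sqrtmxE.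
apply: unitarymx_diag_sqrtC_rank1 (spectral_unitarymx _) (spectral_diag_ge0 psda) _.
exact: psdmx_spectral.
Qed.

(** A projector is its own square root, so the matrix under the trace norm has rank one and the norm
    is the length of [a], the image of [v] under the root of [tau]. *)
Lemma fidelity_pure n (v : 'rV[C]_n) (tau : 'M[C]_n) :
  v *m v ^t* = 1%:M -> psdmx tau ->
  ((fidelity (v ^t* *m v) tau) ^+ 2)%:C%C = (v *m tau *m v ^t*) 0 0.
Proof.
move=> v1 psdt; rewrite /fidelity sqrtmx_idem; last 2 first.
- exact: psdmx_gram.
- by rewrite mulmxA -(mulmxA (v ^t*)) v1 mulmx1.
rewrite /trace_norm; move: (sqrtmx_mul_adj psdt); move: (sqrtmx tau) => q qE.
set a := v *m q.
have -> : v ^t* *m v *m q = v ^t* *m a by rewrite /a mulmxA.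
rewrite adjmx_mul trmxCK mulmxA -(mulmxA (a ^t*)) v1 mulmx1 tr_sqrtmx_rank1.
have -> : a *m a ^t* = v *m tau *m v ^t*.
  by rewrite /a adjmx_mul mulmxA -(mulmxA v) qE.
have [_ /(_ v) f0] := psdt.
rewrite rmorphXn /= RRe_real; first exact: sqrtCK.
by rewrite ger0_real // sqrtC_ge0.
Qed.
End Fidelity.

(** * Light cones *)

Lemma leq_card_bigcup (I T : finType) (J : {set I}) (F : I -> {set T}) (B : nat) :
  {in J, forall i, (#|F i| <= B)%N} ->
  (#|\bigcup_(i in J) F i| <= #|J| * B)%N.
Proof.
move=> FB; rewrite -sum_nat_const.
elim/big_rec2: _ => [|i m A Ji Am]; first by rewrite cards0.
by rewrite (leq_trans (leq_card_setU _ _)) // leq_add ?FB.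
Qed.

(** In an independent set of maximal size, every outside point is related to a member, so the
    neighbourhoods of the members cover everything. *)
Lemma exists_independent (T : finType) (e : rel T) (B : nat) :
  reflexive e -> symmetric e -> (forall x, (#|[set y | e x y]| <= B)%N) ->
  exists2 J : {set T}, {in J &, forall x y, e x y -> x = y} &
    (#|T| <= #|J| * B)%N.
Proof.
move=> er es eB.
pose P (J : {set T}) := [forall x in J, forall y in J, e x y ==> (x == y)].
have P0 : P finset.set0 by apply/forall_inP => x; rewrite inE.
case: (@arg_maxnP _ _ P (fun J => #|J|) P0) => J PJ maxJ; exists J.
  move=> x y xJ yJ exy; move/forall_inP/(_ x xJ)/forall_inP/(_ y yJ): PJ.
  by rewrite exy => /eqP.
have cov y : exists2 x, x \in J & e x y.
  have [yJ|yJ] := boolP (y \in J); first by exists y.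
  apply/exists_inP; apply: contraT => /exists_inPn nex.
  suff /maxJ : P (y |: J) by rewrite /= cardsU1 yJ /geq /= ltnn.
  apply/forall_inP => a /setU1P aJ; apply/forall_inP => b /setU1P bJ.
  apply/implyP => eab; case: aJ bJ eab => [->|aJ] [->|bJ] eab //.
  - by have := nex b bJ; rewrite es eab.
  - by have := nex a aJ; rewrite eab.
  - by move/forall_inP/(_ a aJ)/forall_inP/(_ b bJ): PJ; rewrite eab.
rewrite -cardsT.
apply: leq_trans (leq_card_bigcup (F := fun x => [set y | e x y]) _) => //.
apply: subset_leq_card; apply/fintype.subsetP => y _.
by have [x xJ exy] := cov y; apply/finset.bigcupP; exists x; rewrite ?inE.
Qed.

HB.instance Definition _ (R : realType) n := gen_eqMixin (@gate R n).

Section LightCones.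
Context {R : realType} {n : nat}.
Implicit Types (l : seq (@gate R n)) (c : seq (seq (@gate R n))).
Implicit Types (i j m : 'I_n) (E : rel 'I_n).

Definition coupled l i j :=
  (i == j) || has (fun g => (i \in gate_supp g) && (j \in gate_supp g)) l.

(* [i] lies in the forward light cone of [j]; the head of [c] is the layer applied
   last. *)
Fixpoint reach c i j :=
  if c is l :: c' then [exists m, coupled l i m && reach c' m j] else i == j.

Lemma coupled_sym l : symmetric (coupled l).
Proof.
by move=> i j; rewrite /coupled eq_sym; under eq_has do rewrite andbC.
Qed.

Lemma reach_refl c i : reach c i i.
Proof.
elim: c => [|l c IH] //=; apply/existsP; exists i.
by rewrite IH /coupled eqxx.
Qed.

Lemma reach_cat c1 c2 i j :
  reach (c1 ++ c2) i j = [exists m, reach c1 i m && reach c2 m j].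
Proof.
elim: c1 i => [|l c1 IH] i /=.
  apply/idP/existsP => [rij|[m /andP[/eqP-> //]]].
  by exists i; rewrite eqxx.
apply/existsP/existsP => [[m /andP[lim]]|[m /andP[/existsP[q /andP[liq rqm]] rmj]]].
  rewrite IH => /existsP[q /andP[rmq rqj]]; exists q; rewrite rqj andbT.
  by apply/existsP; exists m; rewrite lim.
exists q; rewrite liq IH; apply/existsP; exists m; by rewrite rqm.
Qed.

(** Backward cones are forward cones of the reversed circuit, which has the same depth and valid
    layers, so one cardinality bound serves both directions. *)
Lemma reach_rev c i j : reach (rev c) i j = reach c j i.
Proof.
elim: c i j => [|l c IH] i j /=; first by rewrite eq_sym.
rewrite rev_cons -cats1 reach_cat; apply: eq_existsb => m.
rewrite IH andbC /= coupled_sym; congr andb.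
by apply/existsP/idP => [[q /andP[? /eqP<- //]]|ljm]; exists j; rewrite ljm eqxx.
Qed.

(** Disjointness of supports leaves at most one gate on [j]. An idle [j] gives i1 = i2 = j. *)
Lemma coupled_pair E l j : symmetric E -> is_layer E l ->
  exists i1 i2, [/\ forall m, coupled l m j -> m = i1 \/ m = i2
    & i1 = i2 \/ E i1 i2].
Proof.
move=> symE /and3P[ul _ El].
have [hj|nj] := boolP (has (fun g => j \in gate_supp g) l); last first.
  exists j, j; split=> [m /orP[/eqP->|/hasP[g gl /andP[_ jg]]]|]; try by left.
  by move/hasPn/(_ g gl): nj; rewrite jg.
case/hasP: hj => g gl jg.
exists (gate_fst g), (gate_snd g); split; last by right; apply: (allP El).
have insupp m : m \in gate_supp g -> m = gate_fst g \/ m = gate_snd g.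
  by rewrite !inE => /orP[/eqP->|/eqP->]; [left|right].
move=> m /orP[/eqP-> //|/hasP[h hl /andP[mh jh]]]; first exact: insupp.
suff mg : m \in gate_supp g by exact: insupp.
clear insupp El; elim: l ul gl hl => // a l IH.
rewrite -[flatten _]/(gate_supp a ++ flatten (map (@gate_supp R n) l)) cat_uniq.
move=> /and3P[_ /hasPn al ul].
have notal g' : j \in gate_supp a -> j \in gate_supp g' -> g' \in l -> False.
  move=> ja jg' g'l; move/(_ j): al; rewrite /= ja => /(_ _)/negP; apply => //.
  by apply/flattenP; exists (gate_supp g') => //; apply: map_f.
case/predU1P=> [ga|gl] /predU1P[ha|hl].
- by subst g h.
- by subst g; case: (notal h).
- by subst h; case: (notal g).
- exact: IH.
Qed.

Lemma card_reach_all_to_all c j : all (is_layer (fun _ _ => true)) c ->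
  (#|[set i | reach c i j]| <= 2 ^ size c)%N.
Proof.
elim: c => [|l c IH] /=.
  by move=> _; rewrite (eq_card (B := pred1 j)) ?card1 // => i; rewrite inE.
move=> /andP[ll /IH cj]; rewrite expnS mulnC.
apply: (@leq_trans (#|[set i | reach c i j]| * 2)); last by rewrite leq_mul2r cj.
apply: leq_trans (leq_card_bigcup (F := fun m => [set i | coupled l i m]) _).
  apply: subset_leq_card; apply/fintype.subsetP => i; rewrite inE.
  case/existsP=> m /andP[lim rmj]; apply/finset.bigcupP.
  by exists m; rewrite inE.
move=> m _; have [//|i1 [i2 [ii _]]] := coupled_pair m _ ll.
apply: (@leq_trans #|[set i1; i2]|); last by rewrite cards2; case: eqP.
by apply: subset_leq_card; apply/fintype.subsetP => i; rewrite !inE => /ii[]->;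
  rewrite eqxx ?orbT.
Qed.

Section Lattice.
Variables (D : nat) (pos : 'I_n -> {ffun 'I_D -> int}).
Let near (a b : 'I_n) := nearest_neighbours (pos a) (pos b).

Lemma near_sym : symmetric near.
Proof.
move=> a b; rewrite /near /nearest_neighbours; congr (_ == _).
by apply: eq_bigr => u _; rewrite distnC.
Qed.

Lemma near_coord a b u : near a b -> (`|pos a u - pos b u|%N <= 1)%N.
Proof. by move/eqP <-; rewrite (bigD1 u) //= leq_addr. Qed.

Lemma reach_coord c i j u : all (is_layer near) c -> reach c i j ->
  (`|pos i u - pos j u|%N <= size c)%N.
Proof.
elim: c i => [|l c IH] i /=; first by move=> _ /eqP->; rewrite subrr.
move=> /andP[ll cc] /existsP[m /andP[lim /(IH _ cc) mj]].
suff : (`|pos i u - pos m u|%N <= 1)%N by lia.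
have [i1 [i2 [ii n12]]] := coupled_pair m near_sym ll.
have mm : coupled l m m by rewrite /coupled eqxx.
have n12' : (`|pos i1 u - pos i2 u|%N <= 1)%N.
  by case: n12 => [->|/near_coord //]; rewrite subrr.
by case: (ii i lim) => ->; case: (ii m mm) => ->; lia.
Qed.

(** Applying [reach_coord] to all layers would allow 2 d + 1 values per coordinate at depth d.
    Treating the layer applied first separately saves one: it spreads [j] over two sites whose
    coordinates differ by at most 1, and the other d - 1 layers widen this by d - 1 on each side. *)
Lemma card_reach_lattice c j : injective pos -> (0 < size c)%N ->
  all (is_layer near) c -> (#|[set i | reach c i j]| <= (2 * size c) ^ D)%N.
Proof.
move=> injpos; case/lastP: c => // c l _; rewrite size_rcons all_rcons.
case/andP=> ll cc; set d := size c.
have [i1 [i2 [ii n12]]] := coupled_pair j near_sym ll.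
have n12' u : (`|pos i1 u - pos i2 u|%N <= 1)%N.
  by case: n12 => [->|/near_coord //]; rewrite subrr.
(* With [d] now the number of remaining layers, the coordinates lie between the smaller one minus d
   and the larger one plus d, a window of at most 2 (d + 1) integers. *)
pose lo u := Num.min (pos i1 u) (pos i2 u) - d%:Z.
have near_j i u : reach (rcons c l) i j -> 0 <= pos i u - lo u < (2 * d.+1)%:Z.
  rewrite -cats1 reach_cat => /existsP[m /andP[/(reach_coord u cc) im]].
  case/existsP=> q /andP[lmq /eqP qj]; rewrite {q}qj in lmq.
  rewrite /lo; have := n12' u; move: im; rewrite -/d.
  by case: (ii m lmq) => ->; lia.
pose f i : {ffun 'I_D -> 'I_(2 * d.+1).-1.+1} :=
  [ffun u => inord `|pos i u - lo u|%N].
have injf : {in [set i | reach (rcons c l) i j] &, injective f}.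
  move=> a b; rewrite !inE => ra rb /ffunP fab; apply: injpos.
  apply/ffunP => u; move: (fab u); rewrite !ffunE => /(congr1 val) /=.
  have := near_j a u ra; have := near_j b u rb.
  by move=> hb ha; rewrite !inordK; lia.
rewrite -(card_in_imset injf); apply: leq_trans (max_card _) _.
by rewrite card_ffun !card_ord prednK ?muln_gt0.
Qed.

End Lattice.
End LightCones.

(** * Random erasures and logarithms *)

Section RandomSubset.
Context {R : realType} {n : nat}.
Variable p : R.
Implicit Types (A T : {set 'I_n}).

Definition erasure_prob T : R := \prod_(i < n) (if i \in T then p else 1 - p).

Lemma erasure_prob_ge0 T : 0 <= p <= 1 -> 0 <= erasure_prob T.
Proof.
move=> /andP[p0 p1]; apply: prodr_ge0 => i _.
by case: ifP; rewrite ?p0 // subr_ge0.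
Qed.

(** Giving weight 0 to the survival of a qubit of [A] encodes the inclusion in the product, which
    then sums independently over the qubits. *)
Lemma prob_erase_superset A :
  \sum_(T : {set 'I_n}) erasure_prob T * (A \subset T)%:R = p ^+ #|A|.
Proof.
transitivity (\sum_(T in {set 'I_n}) \prod_(i < n)
    (if i \in T then p else if i \in A then 0 else 1 - p)).
  apply: eq_bigr => T _; rewrite /erasure_prob.
  have [/fintype.subsetP AT|/subsetPn[i iA iT]] := boolP (A \subset T).
    rewrite mulr1; apply: eq_bigr => i _.
    by case: ifPn => // iT; case: ifP => // /AT; rewrite (negPf iT).
  by rewrite mulr0 (bigD1 i) //= (negPf iT) iA mul0r.
transitivity (\prod_(i < n) (p + (if i \in A then 0 else 1 - p))).
  by rewrite bigA_distr.
rewrite (eq_bigr (fun i => if i \in A then p else 1)).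
  by rewrite -big_mkcond prodr_const.
by move=> i _; case: ifP => _; rewrite ?addr0 // addrC subrK.
Qed.

(** The set [A] is there for the induction: the indicator of not containing C_j is 1 minus that of
    containing it, and the subtracted term replaces [A] by its union with C_j, whose cardinality
    adds up by disjointness. *)
Lemma prob_erase_avoiding (I : eqType) (C : I -> {set 'I_n}) (s : seq I) A :
  uniq s -> {in s &, forall i j, i != j -> [disjoint C i & C j]} ->
  {in s, forall i, [disjoint A & C i]} ->
  \sum_(T : {set 'I_n}) erasure_prob T * (A \subset T)%:R
      * (all (fun j => ~~ (C j \subset T)) s)%:R =
    p ^+ #|A| * \prod_(j <- s) (1 - p ^+ #|C j|).
Proof.
elim: s A => [|j s IH] A.
  move=> _ _ _; rewrite big_nil mulr1 -prob_erase_superset.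
  by apply: eq_bigr => T _; rewrite mulr1.
move=> /= /andP[js us] disjC disjA; rewrite big_cons.
have disjC' : {in s &, forall i j, i != j -> [disjoint C i & C j]}.
  by move=> a b sa sb; apply: disjC; rewrite inE ?sa ?sb orbT.
have jj : j \in j :: s by rewrite inE eqxx.
have disjA' : {in s, forall i, [disjoint A & C i]}.
  by move=> i si; apply: disjA; rewrite inE si orbT.
rewrite mulrBl mul1r mulrBr -(IH A) // mulrA -exprD.
have -> : (#|A| + #|C j|)%N = #|A :|: C j|.
  by apply/esym/eqP; rewrite (leq_card_setU A (C j)).2 disjA.
rewrite -(IH (A :|: C j)) //; last first.
  move=> i si; rewrite -finset.setI_eq0 finset.setIUl finset.setU_eq0 !finset.setI_eq0 disjA' //=.
  apply: disjC => //.
    by rewrite inE si orbT.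
  by apply: contraNneq js => ->.
rewrite -sumrB; apply: eq_bigr => T _; rewrite finset.subUset.
by case: (A \subset T); case: (C j \subset T); case: all;
  rewrite /= ?mulr1 ?mulr0 ?subr0 ?subrr.
Qed.

Lemma sum_erasure_prob : \sum_(T : {set 'I_n}) erasure_prob T = 1.
Proof.
rewrite -(expr0 p) -(@finset.cards0 'I_n) -prob_erase_superset.
by apply: eq_bigr => T _; rewrite finset.sub0set mulr1.
Qed.

Lemma prod_surv_le (I : finType) (C : I -> {set 'I_n}) (J : {set I}) (L : nat) :
  0 < p < 1 -> (forall j, (#|C j| <= L)%N) ->
  \prod_(j in J) (1 - p ^+ #|C j|) <= (1 + #|J|%:R * p ^+ L)^-1.
Proof.
move=> /andP[p0 p1] CL; have pL0 : 0 < p ^+ L by exact: exprn_gt0.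
have pL1 : p ^+ L <= 1 by rewrite exprn_ile1 ?ltW.
apply: (@le_trans _ _ ((1 - p ^+ L) ^+ #|J|)).
  rewrite -prodr_const; apply: ler_prod => j _.
  rewrite subr_ge0 exprn_ile1 ?(ltW p0) ?(ltW p1) //=.
  by rewrite lerD2l lerN2 ler_wiXn2l ?(ltW p0) ?(ltW p1).
have D0 : 0 < 1 + #|J|%:R * p ^+ L.
  by apply: ltr_pwDl => //; rewrite mulr_ge0 // ltW.
rewrite -[X in _ <= X]mul1r ler_pdivlMr //.
(* With q = p^L, this combines Bernoulli, 1 + m q <= (1 + q)^m, with (1 - q)(1 + q) <= 1. *)
apply: (@le_trans _ _ ((1 - p ^+ L) ^+ #|J| * (1 + p ^+ L) ^+ #|J|)).
  rewrite ler_wpM2l ?exprn_ge0 ?subr_ge0 //.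
  elim: #|J| => [|m IH]; first by rewrite mul0r addr0 expr0.
  rewrite exprS -natr1.
  have E1 : 1 <= (1 + p ^+ L) ^+ m by rewrite exprn_ege1 // lerDl ltW.
  by have := ler_wpM2l (ltW pL0) E1; lra.
rewrite -exprMn exprn_ile1 //; nra.
Qed.

End RandomSubset.

Section Logarithms.
Context {R : realType}.

(** Write ln x as 2 ln (sqrt x) and use ln y <= y - 1. *)
Lemma lnBnd (x : R) : 0 < x -> ln x <= 2 * Num.sqrt x.
Proof.
move=> x0; have s0 : 0 < Num.sqrt x by rewrite sqrtr_gt0.
rewrite -{1}(sqr_sqrtr (ltW x0)) lnXn // mulr_natl lerMn2r /=.
have : ln (1 + (Num.sqrt x - 1)) <= Num.sqrt x - 1 by apply: le_ln1Dx; lra.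
by rewrite [1 + _]addrC subrK; lra.
Qed.

Lemma ln2_gt0 : 0 < ln (2 : R).
Proof. by rewrite ln_gt0 // ltr1n. Qed.

Lemma log2M (x y : R) : 0 < x -> 0 < y -> log2 (x * y) = log2 x + log2 y.
Proof. by move=> x0 y0; rewrite /log2 lnM ?posrE // mulrDl. Qed.

Lemma log2X (x : R) m : 0 < x -> log2 (x ^+ m) = m%:R * log2 x.
Proof. by move=> x0; rewrite /log2 lnXn // -[_ *+ m]mulr_natl mulrA. Qed.

Lemma log2_2 : log2 (2 : R) = 1.
Proof. by rewrite /log2 divff // gt_eqF // ln2_gt0. Qed.

Lemma log2_gt0 (x : R) : 1 < x -> 0 < log2 x.
Proof. by move=> x1; rewrite /log2 divr_gt0 ?ln_gt0 ?ltr1n. Qed.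

Lemma ler_log2 (x y : R) : 0 < x -> x <= y -> log2 x <= log2 y.
Proof.
move=> x0 xy; rewrite /log2 ler_wpM2r ?invr_ge0 ?(ltW ln2_gt0) //.
by rewrite ler_ln ?posrE // (lt_le_trans x0).
Qed.

Variable p : R.
Hypothesis p01 : 0 < p < 1.

(* As ln L <= 2 sqrt L, this absorbs the term 2 log L into L log (1/p) for all
   L >= d > 0. At d = 0, where L = 1, it is the junk value 0, which suffices. *)
Definition log_correction (d : nat) : R := 4 / ln (1 / p) / Num.sqrt d%:R.

Let p_gt0 : 0 < p. Proof. by case/andP: p01. Qed.

Lemma inv_gt1 : 1 < 1 / p.
Proof. by rewrite div1r invf_gt1 //; case/andP: p01. Qed.

Lemma log_correction_ge0 d : 0 <= log_correction d.
Proof. by rewrite !divr_ge0 ?sqrtr_ge0 // ltW // ln_gt0 // inv_gt1. Qed.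

Lemma log_correction_cvg : (log_correction @ \oo --> (0 : R))%classic.
Proof.
rewrite -(mulr0 (4 / ln (1 / p))); apply: cvgMr.
have -> : (fun d : nat => (Num.sqrt d%:R)^-1 : R) = (fun d => Num.sqrt d%:R^-1).
  by apply/funext => d; rewrite sqrtrV.
rewrite -[X in (_ --> X)%classic]sqrtr0; apply: continuous_cvg.
  exact: sqrt_continuous.
by rewrite -cvg_shiftS; exact: cvg_harmonic.
Qed.

Lemma log2_bound (eps : R) (k L : nat) :
  0 < eps -> (0 < k)%N -> (0 < L)%N ->
  3 * k%:R * p ^+ L <= 8 * eps ^+ 2 * L%:R ^+ 2 ->
  log2 (3 / (8 * eps ^+ 2)) + log2 k%:R <= L%:R * log2 (1 / p) + 2 * log2 L%:R.
Proof.
move=> e0 k0 L0 H; have e20 : 0 < 8 * eps ^+ 2 by rewrite mulr_gt0 ?exprn_gt0.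
have kR : 0 < k%:R :> R by rewrite ltr0n.
have LR : 0 < L%:R :> R by rewrite ltr0n.
have ip : 0 < 1 / p by rewrite divr_gt0.
rewrite -log2X // -[2]/(2%:R) -log2X // -log2M ?divr_gt0 //.
rewrite -log2M ?exprn_gt0 //; apply: ler_log2.
  by rewrite mulr_gt0 ?divr_gt0.
rewrite mulrAC ler_pdivrMr // div1r exprVn -mulrA [_^-1 * _]mulrC.
by rewrite ler_pdivlMr ?exprn_gt0 // [L%:R ^+ 2 * _]mulrC.
Qed.

Lemma log2_asymptotic (X : R) (d L : nat) :
  (d <= L)%N -> (0 < L)%N -> (d = 0%N -> L = 1%N) ->
  X <= L%:R * log2 (1 / p) + 2 * log2 L%:R ->
  X / ((1 + log_correction d) * log2 (1 / p)) <= L%:R.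
Proof.
move=> dL L0 d0 XL; have o0 := log_correction_ge0 d.
have b0 := log2_gt0 inv_gt1.
rewrite ler_pdivrMr; last by rewrite mulr_gt0 // ltr_pwDl.
apply: (le_trans XL); rewrite [leRHS](_ : _ = L%:R * log2 (1 / p) +
  L%:R * log_correction d * log2 (1 / p)); last by ring.
rewrite lerD2l.
have lp0 : 0 < ln (1 / p) by rewrite ln_gt0 // inv_gt1.
(* The ln (1/p) in the denominator of the correction cancels, leaving 2 ln L <= 4 L / sqrt d to
   prove; this follows from ln L <= 2 sqrt L and d <= L. *)
have -> : L%:R * log_correction d * log2 (1 / p) =
    4 * (L%:R / Num.sqrt d%:R) / ln 2.
  rewrite /log_correction /log2; have := ln2_gt0; move: (ln 2) => l2 l20.
  move: (ln (1 / p)) lp0 (Num.sqrt d%:R)^-1 => l lp0 s.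
  by field; rewrite !gt_eqF.
rewrite /log2 mulrA ler_wpM2r ?invr_ge0 ?(ltW ln2_gt0) //.
case: d dL d0 {o0} => [|d] dL d0; first by rewrite d0 // ln1 sqrtr0 invr0 !mulr0.
have LR : 0 < L%:R :> R by rewrite ltr0n.
have sd0 : 0 < Num.sqrt d.+1%:R :> R by rewrite sqrtr_gt0 ltr0n.
have sL0 : 0 < Num.sqrt L%:R :> R by rewrite sqrtr_gt0.
suff : Num.sqrt L%:R <= L%:R / Num.sqrt d.+1%:R :> R by have := lnBnd LR; lra.
rewrite ler_pdivlMr // -[X in _ <= X](sqr_sqrtr (ltW LR)) expr2.
by rewrite ler_wpM2l ?(ltW sL0) // ler_wsqrtr // ler_nat.
Qed.

End Logarithms.

Lemma log2_ge0 (R : realType) (x : R) : 1 <= x -> 0 <= log2 x.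
Proof. by move=> x1; rewrite /log2 divr_ge0 ?ln_ge0 // ler1n. Qed.

Lemma log2_exp (R : realType) (d : nat) : log2 (2 ^ d)%:R = d%:R :> R.
Proof. by rewrite natrX log2X ?log2_2 ?mulr1. Qed.

Lemma log2_le_exp (R : realType) (y : R) (d : nat) :
  y <= (2 ^ d)%:R -> log2 y <= d%:R.
Proof.
(* [ln] takes the value 0 on nonpositive arguments, and 0 <= d. *)
move=> yd; have [y0|y0] := leP y 0; first by rewrite /log2 ln0 // mul0r ler0n.
by rewrite -log2_exp; apply: ler_log2.
Qed.

Lemma log2_inv_error_ge0 (R : realType) (eps : R) (k : nat) :
  0 < eps -> eps < 1 / 10 -> (0 < k)%N ->
  0 <= log2 (3 / (8 * eps ^+ 2)) + log2 k%:R.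
Proof.
move=> e0 e1 k0; rewrite addr_ge0 ?log2_ge0 ?ler1n //.
have e2 : 0 < eps ^+ 2 by rewrite exprn_gt0.
have : eps ^+ 2 <= (1 / 10) ^+ 2 by rewrite lerXn2r // ?nnegrE ltW.
by rewrite ler_pdivlMr ?mulr_gt0 // mul1r; lra.
Qed.

(** * Locality of operators *)

Section OperatorEntries.
Context {R : realType}.
Implicit Types T : finType.

Lemma opE_mkop T (f : T -> T -> R[i]) x y : opE (mkop f) x y = f x y.
Proof. by rewrite /opE mxE !enum_rankK. Qed.

Lemma opP T (A B : op R T) : (forall x y, opE A x y = opE B x y) -> A = B.
Proof.
move=> AB; apply/matrixP => i j.
by have := AB (enum_val i) (enum_val j); rewrite /opE !enum_valK.
Qed.

Lemma sum_enum_rank (V : nmodType) T (f : 'I_#|{: T}| -> V) :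
  \sum_i f i = \sum_(x : T) f (enum_rank x).
Proof. by rewrite (reindex _ (onW_bij _ (enum_rank_bij T))). Qed.

Lemma opE_mul T (A B : op R T) x z :
  opE (A *m B) x z = \sum_y opE A x y * opE B y z.
Proof. by rewrite /opE mxE sum_enum_rank. Qed.

Lemma opE_adj T (A : op R T) x y : opE (A ^t*) x y = (opE A y x)^*.
Proof. by rewrite /opE !mxE. Qed.

Lemma opE1 T (x y : T) : opE (1%:M : op R T) x y = (x == y)%:R.
Proof. by rewrite /opE mxE (inj_eq enum_rank_inj). Qed.

Lemma mxtrace_op T (A : op R T) : \tr A = \sum_x opE A x x.
Proof. by rewrite /mxtrace sum_enum_rank. Qed.

Lemma opE_delta T (a b x y : T) :
  opE (delta_mx (enum_rank a) (enum_rank b) : op R T) x y = ((x == a) && (y == b))%:R.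
Proof. by rewrite /opE mxE !(inj_eq enum_rank_inj). Qed.

Lemma mxtrace_delta T (a b : T) :
  \tr (delta_mx (enum_rank a) (enum_rank b) : op R T) = (a == b)%:R.
Proof.
rewrite mxtrace_op (bigD1 a) //= big1 => [|z za]; last by rewrite opE_delta (negPf za).
by rewrite opE_delta eqxx addr0.
Qed.

Lemma opE_sum T (I : finType) (F : I -> op R T) x y :
  opE (\sum_i F i) x y = \sum_i opE (F i) x y.
Proof. by rewrite /opE summxE. Qed.

Lemma opEZ T c (A : op R T) x y : opE (c *: A) x y = c * opE A x y.
Proof. by rewrite /opE mxE. Qed.

(** Testing against matrix units recovers the entries. This allows identities between states to be
    proved on observables, in the Heisenberg picture. *)
Lemma trace_separates T (A A' : op R T) :
  (forall B, \tr (A *m B) = \tr (A' *m B)) -> A = A'.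
Proof.
move=> AA'; apply: opP => x y.
have trE (M : op R T) : \tr (M *m delta_mx (enum_rank y) (enum_rank x)) = opE M x y.
  rewrite mxtrace_op (bigD1 x) //= opE_mul (bigD1 y) //= opE_delta !eqxx mulr1.
  rewrite big1 => [|z zy]; last by rewrite opE_delta (negPf zy) mulr0.
  rewrite big1 ?addr0 // => z zx; rewrite opE_mul big1 // => t _.
  by rewrite opE_delta (negPf zx) andbF mulr0.
by rewrite -!trE.
Qed.

End OperatorEntries.

Section Locality.
Context {R : realType} {n : nat}.
Implicit Types (S T : {set 'I_n}) (A B : op R (qubits n)) (x y z : qubits n).

(** Entrywise form of an operator on [S] tensored with the identity elsewhere: it is diagonal off
    [S], and its entries do not depend on the common bits there. *)
Definition supported S A :=
  (forall x y i, i \notin S -> x i != y i -> opE A x y = 0) /\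
  (forall x y x' y', {in S, x =1 x'} -> {in S, y =1 y'} ->
     {in ~: S, x =1 y} -> {in ~: S, x' =1 y'} -> opE A x y = opE A x' y').

Lemma supportedS S S' A : S \subset S' -> supported S A -> supported S' A.
Proof.
move=> /fintype.subsetP SS' [A1 A2]; split=> [x y i iS'|x y x' y' xx' yy' xy xy'].
  by apply: A1; apply: contra iS' => /SS'.
have [/forallP eqxy|] := boolP [forall i, (i \notin S) ==> (x i == y i)].
  have eqxy' i : i \notin S -> x i = y i by move=> iS; apply/eqP/(implyP (eqxy i)).
  apply: A2 => i; rewrite ?inE => iS.
  - exact/xx'/SS'.
  - exact/yy'/SS'.
  - exact: eqxy'.
  - have [iS'|iS'] := boolP (i \in S'); last by rewrite xy' ?inE.
    by rewrite -xx' // -yy' // eqxy'.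
rewrite negb_forall => /existsP-[i ]; rewrite negb_imply => /andP[iS xyi].
have iS' : i \in S' by apply: contraNT xyi => iS'; rewrite xy ?inE.
by rewrite (A1 x y i) // (A1 x' y' i) // -xx' // -yy'.
Qed.

Lemma supported_adj S A : supported S A -> supported S (A ^t*).
Proof.
move=> [A1 A2]; split=> [x y i iS xy|x y x' y' xx' yy' xy xy']; rewrite !opE_adj.
  by rewrite (A1 y x i) ?conjC0 // eq_sym.
by congr (_^*); apply: A2 => // i iS; rewrite ?xy ?xy'.
Qed.

Lemma supported_comm S A B : supported S A -> supported (~: S) B ->
  A *m B = B *m A.
Proof.
move=> [A1 A2] [B1 B2]; apply: opP => x z; rewrite !opE_mul.
(* Each product has a single contributing intermediate string: [y0] when [B] acts first, [y1] when
   [A] does. The remaining factors agree because they differ only in spectator bits. *)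
pose y0 : qubits n := [ffun i => if i \in S then z i else x i].
pose y1 : qubits n := [ffun i => if i \in S then x i else z i].
rewrite (bigD1 y0) //= [X in _ + X]big1 ?addr0 => [|y yy0]; last first.
  have [i yi] : exists i, y i != y0 i.
    by apply/existsP; rewrite -negb_forall; apply: contra yy0 => /forallP h;
      apply/eqP/ffunP => i; apply/eqP.
  move: yi; rewrite ffunE; case: ifPn => iS yi.
    by rewrite (B1 y z i) ?mulr0 // inE iS.
  by rewrite (A1 x y i) ?mul0r // eq_sym.
rewrite [in RHS](bigD1 y1) //= [X in _ = _ + X]big1 ?addr0 => [|y yy1]; last first.
  have [i yi] : exists i, y i != y1 i.
    by apply/existsP; rewrite -negb_forall; apply: contra yy1 => /forallP h;
      apply/eqP/ffunP => i; apply/eqP.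
  move: yi; rewrite ffunE; case: ifPn => iS yi.
    by rewrite (B1 x y i) ?mul0r // ?inE ?iS // eq_sym.
  by rewrite (A1 y z i) ?mulr0.
rewrite mulrC; congr (_ * _).
  by apply: B2 => i; rewrite !inE !ffunE ?negbK => iS; rewrite ?iS ?(negPf iS).
by apply: A2 => i; rewrite ?inE !ffunE => iS; rewrite ?iS ?(negPf iS).
Qed.

(* Commuting with everything localized elsewhere characterizes the operators
   supported on [S], but its stability under products is immediate. *)
Definition commutes_off S A :=
  forall B, supported (~: S) B -> A *m B = B *m A.

Lemma commutes_offS S S' A : S \subset S' -> commutes_off S A -> commutes_off S' A.
Proof.
by move=> SS' cA B sB; apply: cA; apply: supportedS sB; rewrite finset.setCS.
Qed.

Lemma commutes_off_mul S A A' :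
  commutes_off S A -> commutes_off S A' -> commutes_off S (A *m A').
Proof.
by move=> cA cA' B sB; rewrite mulmxA -cA // -!mulmxA cA'.
Qed.

Lemma supported_commutes_off S A : supported S A -> commutes_off S A.
Proof. by move=> sA B; exact: supported_comm. Qed.

End Locality.

Section CircuitLocality.
Context {R : realType} {n : nat}.
Implicit Types (g : @gate R n) (l : seq (@gate R n)) (c : seq (seq (@gate R n))).
Implicit Types (S T : {set 'I_n}) (A B : op R (qubits n)).

Lemma supported_gate g : supported [set i in gate_supp g] (gate_mx g).
Proof.
split=> [x y i|x y x' y' xx' yy' xy xy'].
  rewrite finset.in_set => ig xy; rewrite opE_mkop; case: forallP => [/(_ i)|]; last first.
    by rewrite mulr0.
  by rewrite ig (negPf xy).
rewrite !opE_mkop; have ins : {subset gate_supp g <= [set i in gate_supp g]}.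
  by move=> i; rewrite finset.in_set.
have f : gate_fst g \in gate_supp g by rewrite !inE eqxx.
have s : gate_snd g \in gate_supp g by rewrite !inE eqxx orbT.
rewrite !xx' ?yy' ?ins //; congr (_ * _%:R).
suff off (u v : qubits n) : {in ~: [set i in gate_supp g], u =1 v} ->
    [forall (i | i \notin gate_supp g), u i == v i].
  by rewrite !off.
by move=> uv; apply/forall_inP => i ig; rewrite uv // finset.in_setC finset.in_set.
Qed.

Lemma gate_mx_unitary g : gate_fst g != gate_snd g -> gate_op g \is unitarymx ->
  gate_mx g \is unitarymx.
Proof.
set a := gate_fst g; set b := gate_snd g => ab /unitarymxP Gu.
apply/unitarymxP/opP => x z; rewrite opE1 opE_mul.
(* The strings that agree with [x] off the gate are the four [upd v]; reindexing by [v] reduces the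
   sum to the product of the 4 by 4 matrix [gate_op g] with its adjoint. *)
pose upd (v : bool * bool) : qubits n :=
  [ffun i => if i == a then v.1 else if i == b then v.2 else x i].
have updK v : (upd v a, upd v b) = v.
  by rewrite !ffunE !eqxx eq_sym (negPf ab); case: v.
pose off (u v : qubits n) := [forall (i | i \notin gate_supp g), u i == v i].
have offP (u v : qubits n) : reflect (forall i, i != a -> i != b -> u i = v i) (off u v).
  apply: (iffP forall_inP) => uv i.
    by move=> ia ib; apply/eqP/uv; rewrite !inE negb_or ia.
  by rewrite !inE negb_or => /andP[ia ib]; apply/eqP/uv.
rewrite (bigID (off x)) /= [X in _ + X]big1 ?addr0 => [|y xy]; last first.
  by rewrite opE_mkop -/(off x y) (negPf xy) mulr0 mul0r.
rewrite (reindex upd) /=; last first.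
  exists (fun y : qubits n => (y a, y b)) => [v _|y]; first exact: updK.
  rewrite unfold_in => /offP xy; apply/ffunP => i; rewrite ffunE /=.
  case: eqP => [-> //|/eqP ia]; case: eqP => [-> //|/eqP ib]; exact: xy.
have offx v : off x (upd v).
  by apply/offP => i ia ib; rewrite ffunE (negPf ia) (negPf ib).
rewrite (eq_bigl xpredT) => [|v]; last exact: offx.
have offz v : off z (upd v) = off z x.
  apply/offP/offP => h i ia ib; rewrite h //;
    by rewrite ffunE (negPf ia) (negPf ib).
transitivity ((off z x)%:R * opE (gate_op g *m (gate_op g) ^t*) (x a, x b) (z a, z b)).
  rewrite opE_mul mulr_sumr; apply: eq_bigr => v _.
  rewrite !opE_adj !opE_mkop -/(off x (upd v)) -/(off z (upd v)) offx offz.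
  rewrite -/a -/b !updK mulr1 rmorphM /= conjC_nat; ring.
rewrite Gu opE1 -natrM mulnb; congr (_%:R : R[i]); congr nat_of_bool.
apply/andP/eqP => [[/offP zx /eqP[xa xb]]|->].
  apply/ffunP => i; have [->//|ia] := eqVneq i a; have [->//|ib] := eqVneq i b.
  by rewrite zx.
by split=> //; apply/offP.
Qed.

Lemma layer_mx_unitary E l : is_layer E l -> layer_mx l \is unitarymx.
Proof.
move=> /and3P[ul al _]; elim: l ul al => [|g l IH] /=.
  by move=> _ _; apply/unitarymxP; rewrite mul1mx trmx1 map_mx1.
rewrite inE negb_or => /and3P[/andP[ab _] _ ul] /andP[gu al].
by rewrite mul_unitarymx ?gate_mx_unitary // IH.
Qed.

Lemma circuit_mx_unitary E c : all (is_layer E) c -> circuit_mx c \is unitarymx.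
Proof.
elim: c => [|l c IH] /=.
  by move=> _; apply/unitarymxP; rewrite mul1mx trmx1 map_mx1.
by move=> /andP[/layer_mx_unitary lu /IH]; exact: mul_unitarymx.
Qed.

(** The gates are added one at a time. A gate that misses the region reached so far commutes with
    the evolved operator and cancels against its adjoint; one that meets it lies entirely in the new
    region. *)
Lemma commutes_off_layer E l S A : is_layer E l -> commutes_off S A ->
  commutes_off [set i | [exists m in S, coupled l i m]]
    (layer_mx l *m A *m (layer_mx l) ^t*).
Proof.
move=> /and3P[ul al _] cA; elim: l ul al => [|g l IH].
  move=> _ _; rewrite /= mul1mx trmx1 map_mx1 mulmx1.
  apply: commutes_offS cA; apply/fintype.subsetP => i iS; rewrite inE.
  by apply/exists_inP; exists i => //; rewrite /coupled eqxx.
rewrite -[flatten _]/(gate_supp g ++ flatten (map (@gate_supp R n) l)) cat_uniq.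
move=> /and3P[ug /hasPn gl ul] /= /andP[gu al].
have {IH} := IH ul al; set C := finset _; set L := layer_mx l.
set M := L *m A *m L ^t* => cM.
have -> : gate_mx g *m L *m A *m (gate_mx g *m L) ^t* =
    gate_mx g *m M *m (gate_mx g) ^t*.
  by rewrite adjmx_mul /M !mulmxA.
set C' := finset _.
have CC' : C \subset C'.
  apply/fintype.subsetP => i; rewrite !inE => /exists_inP[m mS lim].
  apply/exists_inP; exists m => //; case/orP: lim => [im|lim]; apply/orP.
    by left.
  by right; rewrite /= lim orbT.
have [disj|] := boolP [disjoint [set i in gate_supp g] & C].
  have sg : supported (~: C) (gate_mx g).
    by apply: supportedS (supported_gate g); rewrite -finset.disjoints_subset.
  rewrite -(cM _ sg) -mulmxA.
  have /unitarymxP -> : gate_mx g \is unitarymx.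
    by apply: gate_mx_unitary => //; move: ug; rewrite /= inE andbT.
  by rewrite mulmx1; apply: commutes_offS cM.
rewrite -finset.setI_eq0 => /finset.set0Pn-[i ].
rewrite finset.in_setI !finset.in_set => /andP[ig /exists_inP[m mS lim]].
(* No other gate of the layer touches [i], so [i] was in the region only as a point of [S]. *)
have im : i = m.
  case/orP: lim => [/eqP //|/hasP[h hl /andP[ih _]]].
  have := gl i; rewrite ig => /(_ _)/negP; case=> //.
  by apply/flattenP; exists (gate_supp h) => //; apply: map_f.
have sgC' : [set i in gate_supp g] \subset C'.
  apply/fintype.subsetP => q; rewrite !finset.in_set => qg; apply/exists_inP.
  by exists m => //; apply/orP; right; rewrite /= -im qg ig.
have sg : supported C' (gate_mx g) by exact: supportedS (supported_gate g).
apply: commutes_off_mul; first apply: commutes_off_mul.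
- exact: supported_commutes_off.
- exact: commutes_offS cM.
- exact/supported_commutes_off/supported_adj.
Qed.

Lemma commutes_off_circuit E c j A : all (is_layer E) c ->
  commutes_off [set j] A ->
  commutes_off [set i | reach c i j] (circuit_mx c *m A *m (circuit_mx c) ^t*).
Proof.
move=> + cA; elim: c => [|l c IH] /=.
  move=> _; rewrite mul1mx trmx1 map_mx1 mulmx1.
  by apply: commutes_offS cA; apply/fintype.subsetP => i; rewrite !inE.
move=> /andP[ll /IH {}cA]; set U := circuit_mx c.
have -> : layer_mx l *m U *m A *m (layer_mx l *m U) ^t* =
    layer_mx l *m (U *m A *m U ^t*) *m (layer_mx l) ^t*.
  by rewrite adjmx_mul !mulmxA.
apply: commutes_offS (commutes_off_layer ll cA).
apply/fintype.subsetP => i; rewrite !inE => /exists_inP[m]; rewrite inE => mS lim.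
by apply/existsP; exists m; rewrite lim.
Qed.

End CircuitLocality.

(** * The erasure channel *)

Section Erasure.
Context {R : realType} {n : nat}.
Local Notation C := R[i].
Implicit Types (S T : {set 'I_n}) (A B X : op R (qubits n)).

(* The [x, y] entry of the image of |a><b| under the complete depolarization of a
   qubit if [t], under the identity otherwise. *)
Definition erasure_kernel (t a b x y : bool) : C :=
  if t then (a == b)%:R * (x == y)%:R / 2 else (x == a)%:R * (y == b)%:R.

Definition erase T X : op R (qubits n) :=
  mkop (fun x y : qubits n => \sum_(a : qubits n) \sum_(b : qubits n) opE X a b *
    \prod_(i < n) erasure_kernel (i \in T) (a i) (b i) (x i) (y i)).

Lemma eraseZ T c X : erase T (c *: X) = c *: erase T X.
Proof.
apply: opP => x y; rewrite opEZ !opE_mkop mulr_sumr; apply: eq_bigr => a _.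
by rewrite mulr_sumr; apply: eq_bigr => b _; rewrite opEZ mulrA.
Qed.

Lemma supported_erase T X : supported (~: T) (erase T X).
Proof.
split=> [x y i|x y x' y' xx' yy' xy xy'].
  rewrite inE negbK => iT xyi; rewrite opE_mkop big1 // => a _; rewrite big1 // => b _.
  by rewrite (bigD1 i) //= iT /erasure_kernel (negPf xyi) mulr0 mul0r mul0r mulr0.
rewrite !opE_mkop; apply: eq_bigr => a _; apply: eq_bigr => b _; congr (_ * _).
apply: eq_bigr => i _; rewrite /erasure_kernel; case: ifPn => iT.
  by rewrite xy ?xy' ?eqxx // !inE negbK.
by rewrite xx' ?yy' // inE.
Qed.

(** The kernel is unchanged when the input pair (a, b) and the output pair (x, y) are exchanged and
    both reversed. *)
Lemma erase_selfadjoint T X B : \tr (erase T X *m B) = \tr (X *m erase T B).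
Proof.
rewrite !mxtrace_op.
under eq_bigr do (rewrite opE_mul; under eq_bigr do
  (rewrite opE_mkop mulr_suml; under eq_bigr do rewrite mulr_suml)).
under [RHS]eq_bigr do (rewrite opE_mul; under eq_bigr do
  (rewrite opE_mkop mulr_sumr; under eq_bigr do rewrite mulr_sumr)).
under eq_bigr do rewrite exchange_big /=.
rewrite exchange_big /=; apply: eq_bigr => a _.
under eq_bigr do rewrite exchange_big /=.
rewrite exchange_big /=; apply: eq_bigr => b _.
rewrite exchange_big /=; apply: eq_bigr => y _; apply: eq_bigr => x _.
rewrite mulrAC -!mulrA; congr (_ * (_ * _)); apply: eq_bigr => i _.
rewrite /erasure_kernel; case: ifP => _.
  by rewrite [in LHS]mulrC (eq_sym (x i)) (eq_sym (a i)) mulrC -!mulrA mulrCA.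
by rewrite mulrC (eq_sym (x i)) (eq_sym (y i)).
Qed.

Lemma erase1 T : erase T 1%:M = 1%:M.
Proof.
apply: opP => x y; rewrite opE1 opE_mkop.
transitivity (\sum_(a : qubits n)
    \prod_(i < n) erasure_kernel (i \in T) (a i) (a i) (x i) (y i)).
  apply: eq_bigr => a _; rewrite (bigD1 a) //= opE1 eqxx mul1r [X in _ + X]big1 ?addr0 // => b ba.
  by rewrite opE1 eq_sym (negPf ba) mul0r.
rewrite -(bigA_distr_bigA (fun (i : 'I_n) (a : bool) =>
  erasure_kernel (i \in T) a a (x i) (y i))).
transitivity (\prod_(i < n) (x i == y i)%:R : C).
  apply: eq_bigr => i _; rewrite big_bool /= /erasure_kernel.
  by case: (i \in T); case: (x i); case: (y i); rewrite /=; field.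
have [->|xy] := eqVneq x y; first by rewrite big1 // => i _; rewrite eqxx.
have [i xyi] : exists i, x i != y i.
  apply/existsP; rewrite -negb_forall; apply: contra xy => /forallP h.
  by apply/eqP/ffunP => i; apply/eqP.
by rewrite (bigD1 i) //= (negPf xyi) mul0r.
Qed.

Lemma mxtrace_erase T X : \tr (erase T X) = \tr X.
Proof. by rewrite -[erase T X]mulmx1 erase_selfadjoint erase1 mulmx1. Qed.

(* In the Heisenberg picture [erase T B] acts off [T], where it commutes with [W]. *)
Lemma erase_conj S T W X : W \is unitarymx -> commutes_off S W -> S \subset T ->
  erase T (W *m X *m W ^t*) = erase T X.
Proof.
move=> Wu cW ST; apply: trace_separates => B; rewrite !erase_selfadjoint.
have cT : commutes_off T W by exact: commutes_offS cW.
rewrite -!mulmxA mxtrace_mulC -!mulmxA; congr (\tr (_ *m _)).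
rewrite -cT; last exact: supported_erase.
by rewrite mulmxA unitarymx_adjmul // mul1mx.
Qed.

(** Complete depolarization has the four Kraus operators |u><v| with weight 1/2. The identity is
    repeated four times with weight 1/4, so that both cases have the same index set and products
    over the qubits can be expanded uniformly. *)
Definition kraus_weight (t : bool) : C := if t then 1 / 2 else 1 / 4.
Definition kraus (t : bool) (s : bool * bool) (x a : bool) : C :=
  if t then (x == s.1)%:R * (a == s.2)%:R else (x == a)%:R.

Lemma erasure_kernel_kraus t a b x y : erasure_kernel t a b x y =
  \sum_s kraus_weight t * (kraus t s x a * kraus t s y b).
Proof.
rewrite -(pair_bigA _ (fun u v => kraus_weight t *
  (kraus t (u, v) x a * kraus t (u, v) y b))) /= !big_bool /=.
rewrite /erasure_kernel /kraus_weight /kraus.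
by case: t; case: a; case: b; case: x; case: y; rewrite /=; field.
Qed.

End Erasure.

(** * Positive semidefinite operators *)

Section Positivity.
Context {R : realType}.
Local Notation C := R[i].

Lemma psdmx_sum_rank1 (T S : finType) (M : op R T) (c : S -> C) (g : S -> T -> C) :
  (forall s, 0 <= c s) ->
  (forall u v, opE M u v = \sum_s c s * (g s u * (g s v)^*)) -> psdmx M.
Proof.
move=> c0 ME; pose G : 'M[C]_(#|S|, #|{: T}|) :=
  \matrix_(i, j) (sqrtC (c (enum_val i)) * (g (enum_val i) (enum_val j))^*).
suff -> : M = G ^t* *m G by exact: psdmx_gram.
apply: opP => u v; rewrite ME /opE mxE sum_enum_rank; apply: eq_bigr => s _.
rewrite !mxE !enum_rankK rmorphM /= conjCK [(sqrtC _)^*]geC0_conj ?sqrtC_ge0 //.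
by rewrite mulrACA -expr2 sqrtCK.
Qed.

Lemma psdmx_form (T : finType) (M : op R T) (f : T -> C) : psdmx M ->
  0 <= \sum_x \sum_y f x * opE M x y * (f y)^*.
Proof.
case=> _ /(_ (\row_i f (enum_val i))); rewrite mxE sum_enum_rank.
rewrite exchange_big /=; congr (_ <= _); apply: eq_bigr => y _.
rewrite !mxE sum_enum_rank mulr_suml enum_rankK; apply: eq_bigr => x _.
by rewrite mxE enum_rankK.
Qed.

Lemma psdmx_diag (T : finType) (M : op R T) u : psdmx M -> 0 <= opE M u u.
Proof.
move/(psdmx_form (fun x => (x == u)%:R)); rewrite (bigD1 u) //= (bigD1 u) //=.
rewrite !eqxx mul1r conjC1 mulr1 big1 => [|y yu]; last first.
  by rewrite (negPf yu) conjC0 mulr0.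
rewrite addr0 big1 ?addr0 // => x xu; rewrite big1 // => y _.
by rewrite (negPf xu) !mul0r.
Qed.

Lemma psdmx_offdiag (T : finType) (M : op R T) u v : psdmx M ->
  opE M u v + opE M v u <= opE M u u + opE M v v.
Proof.
move=> psdM; have [->|uv] := eqVneq u v; first by [].
(* Positivity of the quadratic form at the difference of the basis vectors [u] and [v]. *)
have := psdmx_form (fun x => (x == u)%:R - (x == v)%:R) psdM.
have sumE (h : T -> C) : \sum_x ((x == u)%:R - (x == v)%:R) * h x = h u - h v.
  under eq_bigr do rewrite mulrBl; rewrite sumrB.
  rewrite (bigD1 u) //= eqxx mul1r big1 => [|x /negPf->]; last by rewrite mul0r.
  rewrite (bigD1 v) //= eqxx mul1r big1 => [|x /negPf->]; last by rewrite mul0r.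
  by rewrite !addr0.
under eq_bigr do (under eq_bigr do rewrite -mulrA; rewrite -mulr_sumr).
rewrite sumE.
have sumE' (h : T -> C) : \sum_x h x * ((x == u)%:R - (x == v)%:R)^* = h u - h v.
  rewrite -sumE; apply: eq_bigr => x _.
  by rewrite rmorphB /= !conjC_nat mulrC.
rewrite !sumE' => h; rewrite -subr_ge0; move: h; congr (_ <= _); ring.
Qed.

(** Adding the sum to its transpose pairs each entry with its mirror image; [psdmx_offdiag] bounds
    every pair by diagonal entries, and regularity of [e] counts each of these [m] times. *)
Lemma psdmx_sum_offdiag (L T : finType) (M : op R T) (f : L -> T) (e : rel L) m :
  psdmx M -> symmetric e -> (forall x, #|[pred y | e x y]| = m) ->
  \sum_x \sum_(y | e x y) opE M (f x) (f y) <= m%:R * \sum_x opE M (f x) (f x).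
Proof.
move=> psdM es em; set s := \sum_x \sum_(y | e x y) _.
have sE : s = \sum_x \sum_(y | e x y) opE M (f y) (f x).
  by rewrite (exchange_big_dep xpredT) //=; apply: eq_bigr => x _; apply: eq_bigl => y; rewrite es.
set t := m%:R * _.
have tE : t = \sum_x \sum_(y | e x y) opE M (f x) (f x).
  by rewrite /t mulr_sumr; apply: eq_bigr => x _; rewrite sumr_const em mulr_natl.
have tE' : t = \sum_x \sum_(y | e x y) opE M (f y) (f y).
  rewrite (exchange_big_dep xpredT) //= tE; apply: eq_bigr => x _.
  by rewrite !sumr_const; congr (_ *+ _); apply: eq_card => y; rewrite unfold_in /= es.
suff : s + s <= t + t by rewrite -!mulr2n lerMn2r.
rewrite {1}/s sE {1}tE tE' -!big_split /=; apply: ler_sum => x _.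
rewrite -!big_split /=; apply: ler_sum => y _.
exact: psdmx_offdiag.
Qed.

End Positivity.

(** * The encoded state *)

Section Bitflips.
Context {R : realType} {n : nat}.
Local Notation C := R[i].
Implicit Types (x y : qubits n) (i j : 'I_n).

Definition flip j x : qubits n := [ffun i => if i == j then ~~ x i else x i].

Lemma flipK j : involutive (flip j).
Proof.
by move=> x; apply/ffunP => i; rewrite !ffunE; case: eqP => // _; rewrite negbK.
Qed.

Lemma flip_same j x : flip j x j = ~~ x j.
Proof. by rewrite ffunE eqxx. Qed.

Lemma flip_other j x i : i != j -> flip j x i = x i.
Proof. by move=> ij; rewrite ffunE (negPf ij). Qed.

Lemma card_eq_bit (j : 'I_n) (b : bool) :
  (2 * #|[pred y : qubits n | b == y j]|)%N = (2 ^ n)%N.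
Proof.
have <- : #|{: qubits n}| = (2 ^ n)%N by rewrite card_ffun card_bool card_ord.
rewrite -(cardC [pred y : qubits n | b == y j]) mul2n -addnn; congr addn.
rewrite -(fintype.card_image (inv_inj (flipK j)) [pred y : qubits n | b == y j]).
apply: eq_card => y; apply/fintype.imageP/idP => [[x]|].
  by rewrite !inE => bx ->; rewrite flip_same; move: bx; case: b; case: (x j).
rewrite !inE => by_; exists (flip j y); last by rewrite flipK.
by rewrite inE flip_same; move: by_; case: b; case: (y j).
Qed.

Definition pauliX j : op R (qubits n) := mkop (fun x y => (y == flip j x)%:R).
Definition pauliZ j : op R (qubits n) :=
  mkop (fun x y => (x == y)%:R * (-1) ^+ x j).

Lemma supported_pauliX j : supported [set j] (pauliX j).
Proof.
split=> [x y i|x y x' y' xx' yy' xy xy']; rewrite !opE_mkop.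
  rewrite inE => ij xyi; case: eqP => // yx.
  by rewrite yx flip_other ?eqxx in xyi.
have jj : j \in [set j] by rewrite inE.
have eqE (u v : qubits n) : {in ~: [set j], u =1 v} ->
    (v == flip j u) = (v j == ~~ u j).
  move=> uv; apply/eqP/eqP => [->|vj]; first by rewrite flip_same.
  apply/ffunP => i; have [->|ij] := eqVneq i j; first by rewrite flip_same.
  by rewrite flip_other // uv // !inE.
by rewrite !eqE // xx' // yy'.
Qed.

Lemma supported_pauliZ j : supported [set j] (pauliZ j).
Proof.
split=> [x y i|x y x' y' xx' yy' xy xy']; rewrite !opE_mkop.
  by move=> ij xyi; rewrite (_ : (x == y) = false) ?mul0r //; apply: contraNF xyi => /eqP->.
have jj : j \in [set j] by rewrite inE.
have eqE (u v : qubits n) : {in ~: [set j], u =1 v} -> (u == v) = (u j == v j).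
  move=> uv; apply/eqP/eqP => [->//|vj].
  apply/ffunP => i; have [->//|ij] := eqVneq i j.
  by rewrite uv // !inE.
by rewrite !eqE // xx' // yy'.
Qed.

Lemma pauliX_conj j (M : op R (qubits n)) x y :
  opE (pauliX j *m M *m (pauliX j) ^t*) x y = opE M (flip j x) (flip j y).
Proof.
rewrite opE_mul (bigD1 (flip j y)) //= big1 => [|z zy]; last first.
  by rewrite opE_adj opE_mkop (negPf zy) conjC0 mulr0.
rewrite addr0 opE_adj opE_mkop eqxx conjC1 mulr1 opE_mul (bigD1 (flip j x)) //=.
rewrite big1 => [|z zx]; last by rewrite opE_mkop (negPf zx) mul0r.
by rewrite opE_mkop eqxx mul1r addr0.
Qed.

Lemma pauliZ_conj j (M : op R (qubits n)) x y :
  opE (pauliZ j *m M *m (pauliZ j) ^t*) x y = (-1) ^+ (x j) * (-1) ^+ (y j) * opE M x y.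
Proof.
rewrite opE_mul (bigD1 y) //= big1 => [|z zy]; last first.
  by rewrite opE_adj opE_mkop eq_sym (negPf zy) mul0r conjC0 mulr0.
rewrite addr0 opE_adj opE_mkop eqxx mul1r rmorphXn /= rmorphN /= conjC1.
rewrite opE_mul (bigD1 x) //= big1 => [|z zx]; last first.
  by rewrite opE_mkop eq_sym (negPf zx) !mul0r.
by rewrite opE_mkop eqxx mul1r addr0 mulrAC.
Qed.

Lemma pauliX_unitary j : pauliX j \is unitarymx.
Proof.
apply/unitarymxP; rewrite -[X in X *m _]mulmx1; apply: opP => x y.
by rewrite pauliX_conj !opE1 (inj_eq (inv_inj (flipK j))).
Qed.

Lemma pauliZ_unitary j : pauliZ j \is unitarymx.
Proof.
apply/unitarymxP; rewrite -[X in X *m _]mulmx1; apply: opP => x y.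
rewrite pauliZ_conj !opE1; have [->|_] := eqVneq x y; last by rewrite mulr0.
by rewrite -signr_addb addbb mulr1.
Qed.

End Bitflips.

Section Ampliation.
Context {R : realType}.
Implicit Types A B T : finType.

Definition block A T (X : op R (A * T)%type) (t t' : T) : op R A :=
  mkop (fun a a' => opE X (a, t) (a', t')).

Lemma opE_ampliation A B T (Phi : op R A -> op R B) (X : op R (A * T)%type) u v :
  opE (ampliation Phi X) u v = opE (Phi (block X u.2 v.2)) u.1 v.1.
Proof. by rewrite opE_mkop. Qed.

Lemma block_ampliation A B T (Phi : op R A -> op R B) (X : op R (A * T)%type) t t' :
  block (ampliation Phi X) t t' = Phi (block X t t').
Proof. by apply: opP => x y; rewrite opE_mkop opE_ampliation. Qed.

Lemma mxtrace_block A T (X : op R (A * T)%type) :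
  \tr X = \sum_t \tr (block X t t).
Proof.
rewrite mxtrace_op (eq_bigr (fun u => opE X (u.1, u.2) (u.1, u.2))) => [|[] //].
rewrite -(pair_bigA _ (fun a t => opE X (a, t) (a, t))) /=.
rewrite exchange_big /=; apply: eq_bigr => t _.
by rewrite mxtrace_op; apply: eq_bigr => a _; rewrite opE_mkop.
Qed.

Lemma mxtrace_channel A B T (Phi : {linear op R A -> op R B}) (X : op R (A * T)%type) :
  quantum_channel Phi -> \tr (ampliation Phi X) = \tr X.
Proof.
move=> [_ trPhi]; rewrite !mxtrace_block; apply: eq_bigr => t _.
by rewrite block_ampliation trPhi.
Qed.

End Ampliation.

Section NoisyState.
Context {R : realType}.
Local Notation C := R[i].
Variables (n k : nat) (hkn : (k <= n)%N) (U : op R (qubits n)).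
Hypothesis U_unitary : U \is unitarymx.
Implicit Types (r : qubits k) (T : {set 'I_n}).

Let ketbra r r' : op R (qubits k) := delta_mx (enum_rank r) (enum_rank r').

Lemma block_max_entangled r r' :
  block (@max_entangled R k) r r' = (2 ^ k)%:R^-1 *: ketbra r r'.
Proof. by apply: opP => x y; rewrite opEZ opE_delta !opE_mkop mulrC. Qed.

Lemma add_ancillasZ c (M : op R (qubits k)) :
  add_ancillas hkn (c *: M) = c *: add_ancillas hkn M.
Proof. by apply: opP => x y; rewrite opEZ !opE_mkop opEZ mulrA. Qed.

Lemma encodingZ c (M : op R (qubits k)) :
  encoding hkn U (c *: M) = c *: encoding hkn U M.
Proof. by rewrite /encoding add_ancillasZ -scalemxAr -scalemxAl. Qed.

Definition noisy_state T := ampliation (erase T \o encoding hkn U) (@max_entangled R k).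

Lemma block_noisy_state T r r' :
  block (noisy_state T) r r' = (2 ^ k)%:R^-1 *: erase T (encoding hkn U (ketbra r r')).
Proof. by rewrite block_ampliation /= block_max_entangled encodingZ eraseZ. Qed.

(** Matrix entry of the isometry V that adds the ancillas and applies [U]; the only string in the
    sum is [r] padded with zeros. *)
Definition encoding_isometry (a : qubits n) r : C :=
  \sum_(x | ancillas_zero k x && (logical_part hkn x == r)) opE U a x.

Lemma opE_encoding r r' a b : opE (encoding hkn U (ketbra r r')) a b =
  encoding_isometry a r * (encoding_isometry b r')^*.
Proof.
rewrite opE_mul /encoding_isometry rmorph_sum /= mulr_sumr [RHS]big_mkcond /=.
apply: eq_bigr => y _; rewrite opE_adj opE_mul.
case: ifPn => [/andP[ay ly]|ay].
  rewrite mulr_suml mulr_suml [RHS]big_mkcond; apply: eq_bigr => x _ /=.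
  rewrite opE_mkop opE_delta ay andbT ly andbT.
  by rewrite -mulrA [LHS]mulrCA -natrM mulnb andbC; case: ifP => _;
    rewrite ?mulr1n ?mul0r ?mulr0 ?mulr1 ?mul1r // mulrC.
rewrite big1 ?mul0r // => x _; rewrite opE_mkop opE_delta -natrM mulnb.
move: ay; case: (ancillas_zero k y); rewrite ?andbF ?mulr0 //= => /negPf->.
by rewrite andbF mulr0.
Qed.

(** The vectors are the images of the entangled state under V followed by one Kraus operator per
    qubit; distributing the product of the kernels over the Kraus labels gives the sum of rank-one
    terms. *)
Lemma psdmx_noisy_state T : psdmx (noisy_state T).
Proof.
apply: (@psdmx_sum_rank1 R (qubits n * qubits k)%type
  {ffun 'I_n -> (bool * bool)%type} (noisy_state T)
  (fun s => (2 ^ k)%:R^-1 * \prod_(i < n) kraus_weight (i \in T))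
  (fun s u => \sum_a encoding_isometry a u.2 *
     \prod_(i < n) kraus (i \in T) (s i) (u.1 i) (a i))).
  move=> s; rewrite mulr_ge0 ?invr_ge0 ?ler0n //; apply: prodr_ge0 => i _.
  by rewrite /kraus_weight; case: ifP; rewrite divr_ge0.
move=> [x r] [y r']; have -> : opE (noisy_state T) (x, r) (y, r') =
    opE (block (noisy_state T) r r') x y by rewrite [RHS]opE_mkop.
rewrite block_noisy_state opEZ /= opE_mkop mulr_sumr.
under [LHS]eq_bigr do rewrite mulr_sumr.
have distr c (A B : qubits n -> C) : c * ((\sum_a A a) * (\sum_b B b)^*) =
    \sum_a \sum_b c * (A a * (B b)^*).
  rewrite rmorph_sum big_distrlr /= mulr_sumr; apply: eq_bigr => a _.
  by rewrite mulr_sumr.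
under [RHS]eq_bigr do rewrite distr.
rewrite [RHS]exchange_big /=; apply: eq_bigr => a _.
rewrite [RHS]exchange_big /=; apply: eq_bigr => b _.
rewrite opE_encoding.
under eq_bigr do rewrite erasure_kernel_kraus.
rewrite (bigA_distr_bigA (fun (i : 'I_n) s => kraus_weight (i \in T) *
  (kraus (i \in T) s (x i) (a i) * kraus (i \in T) s (y i) (b i)))).
rewrite mulr_sumr mulr_sumr; apply: eq_bigr => s _.
rewrite !big_split /= rmorphM /= rmorph_prod /=.
have -> : \prod_(i < n) (kraus (i \in T) (s i) (y i) (b i))^* =
   \prod_(i < n) kraus (i \in T) (s i) (y i) (b i) :> C.
  apply: eq_bigr => i _; rewrite /kraus; case: ifP => _.
    by rewrite rmorphM /= !conjC_nat.
  by rewrite conjC_nat.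
ring.
Qed.

Lemma mxtrace_encoding (M : op R (qubits k)) :
  \tr (encoding hkn U M) = \tr (add_ancillas hkn M).
Proof. by rewrite /encoding mxtrace_mulC mulmxA unitarymx_adjmul // mul1mx. Qed.

Lemma mxtrace_add_ancillas r : \tr (add_ancillas hkn (ketbra r r)) <= 1.
Proof.
rewrite mxtrace_op; pose P (x : qubits n) := ancillas_zero k x && (logical_part hkn x == r).
rewrite (eq_bigr (fun x => (P x)%:R)) => [|x _]; last first.
  by rewrite opE_mkop opE_delta !andbb -natrM mulnb andbC.
rewrite -natr_sum -[1]/(1%:R) ler_nat (_ : (\sum_x P x)%N = #|P|); last first.
  by rewrite -sum1_card [RHS]big_mkcond; apply: eq_bigr => x _;
    rewrite -[x \in P]/(P x); case: (P x).
apply/card_le1_eqP => x y; rewrite -[x \in P]/(P x) -[y \in P]/(P y).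
move=> /andP[ax /eqP lx] /andP[ay /eqP ly].
apply/ffunP => i; have [ik|ki] := ltnP i k.
  have := congr1 (fun f : qubits k => f (Ordinal ik)) (etrans lx (esym ly)).
  by rewrite !ffunE (_ : widen_ord hkn (Ordinal ik) = i) //; apply: val_inj.
by move/forall_inP/(_ i ki)/negPf: ax => ->; move/forall_inP/(_ i ki)/negPf: ay => ->.
Qed.

Lemma mxtrace_noisy_state T : \tr (noisy_state T) <= 1.
Proof.
rewrite mxtrace_block.
have K0 : 0 < (2 ^ k)%:R :> C by rewrite ltr0n expn_gt0.
apply: (@le_trans _ _ (\sum_(r : qubits k) (2 ^ k)%:R^-1)); last first.
  by rewrite sumr_const card_ffun card_bool card_ord -[leLHS]mulr_natl divff.
apply: ler_sum => r _; rewrite block_noisy_state mxtraceZ mxtrace_erase mxtrace_encoding.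
by rewrite -[X in _ <= X]mulr1 ler_wpM2l ?invr_ge0 ?(ltW K0) // mxtrace_add_ancillas.
Qed.

Let embed (j : 'I_k) := widen_ord hkn j.

Lemma logical_part_flip j x :
  logical_part hkn (flip (embed j) x) = flip j (logical_part hkn x).
Proof. by apply/ffunP => i; rewrite !ffunE. Qed.

Lemma ancillas_zero_flip j x : ancillas_zero k (flip (embed j) x) = ancillas_zero k x.
Proof.
apply: eq_forallb => i; have [ki|//] := leqP k i; rewrite flip_other //.
by apply: contraTneq ki => ->; rewrite -ltnNge /= ltn_ord.
Qed.

(** On the maximally entangled state a Pauli operator of the reference can be moved to the logical
    qubit; in block form this is an action on the labels, here a flip and for Z a sign. *)
Lemma add_ancillas_pauliX j r r' :
  add_ancillas hkn (ketbra (flip j r) (flip j r')) =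
  pauliX (embed j) *m add_ancillas hkn (ketbra r r') *m (pauliX (embed j)) ^t*.
Proof.
apply: opP => x y; rewrite pauliX_conj !opE_mkop !logical_part_flip.
by rewrite !ancillas_zero_flip !opE_delta !(can2_eq (flipK j) (flipK j)).
Qed.

Lemma add_ancillas_pauliZ j r r' : r j != r' j ->
  - add_ancillas hkn (ketbra r r') =
  pauliZ (embed j) *m add_ancillas hkn (ketbra r r') *m (pauliZ (embed j)) ^t*.
Proof.
move=> rj; apply: opP => x y; rewrite pauliZ_conj -scaleN1r opEZ.
rewrite !opE_mkop !opE_delta.
have [lx|] := eqVneq (logical_part hkn x) r; last by rewrite !mul0r !mulr0.
have [ly|] := eqVneq (logical_part hkn y) r'; last by rewrite !mul0r !mulr0.
congr (_ * _); rewrite -signr_addb; move: rj; rewrite -lx -ly !ffunE.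
by rewrite -/(embed j) addbC; case: (x _); case: (y _).
Qed.

Lemma erase_encoding_conj S T (P : op R (qubits n)) (X : op R (qubits n)) :
  P \is unitarymx -> commutes_off S (U *m P *m U ^t*) -> S \subset T ->
  erase T (U *m (P *m X *m P ^t*) *m U ^t*) = erase T (U *m X *m U ^t*).
Proof.
move=> Pu cP ST; have /= <- := unitarymx_conj_conj P X U_unitary.
by apply: erase_conj cP ST; exact: unitarymx_conj.
Qed.

End NoisyState.

(** * Overlap with the maximally entangled state *)

Section Overlap.
Context {R : realType} {k : nat}.
Local Notation C := R[i].
Implicit Types (tau : op R (qubits k * qubits k)%type) (l r : qubits k).

(** This is <phi|tau|phi> for phi = 2^(-k/2) times the sum of the |l,l>. *)
Definition overlap tau : C :=
  (2 ^ k)%:R^-1 * \sum_l \sum_r opE tau (l, l) (r, r).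

Let dim_gt0 : 0 < (2 ^ k)%:R :> C. Proof. by rewrite ltr0n expn_gt0. Qed.

Lemma mxtrace_pair tau : \tr tau = \sum_l \sum_r opE tau (l, r) (l, r).
Proof.
rewrite mxtrace_op (eq_bigr (fun u => opE tau (u.1, u.2) (u.1, u.2))) => [|[] //].
by rewrite -(pair_bigA _ (fun l r => opE tau (l, r) (l, r))).
Qed.

Lemma overlap_le_trace tau : psdmx tau -> overlap tau <= \tr tau.
Proof.
move=> psdt; rewrite /overlap mulrC ler_pdivrMr // mulrC.
have := @psdmx_sum_offdiag _ _ _ _ (fun l => (l, l)) (fun _ _ => true) (2 ^ k)%N psdt.
move=> /(_ _ _)/le_trans; apply=> //.
  by move=> x; rewrite card_ffun card_bool card_ord.
rewrite ler_wpM2l ?(ltW dim_gt0) // mxtrace_pair; apply: ler_sum => l _.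
by rewrite (bigD1 l) //= lerDl sumr_ge0 // => r _; apply: psdmx_diag.
Qed.

(** Vanishing blocks leave only 2^(k-1) partners [r] for each [l], a first factor 1/2. Flip
    invariance equates the sum along the pairs (l, l) with that along (l, flip j l); their diagonal
    entries are distinct parts of the trace, which gives the second. *)
Lemma overlap_decoupled tau (j : 'I_k) : psdmx tau ->
  (forall r r', r j != r' j -> block tau r r' = 0) ->
  (forall r r', block tau (flip j r) (flip j r') = block tau r r') ->
  overlap tau <= \tr tau / 4.
Proof.
move=> psdt tau0 tauX; pose e l r := l j == r j.
have blockE l l' r r' : opE tau (l, r) (l', r') = opE (block tau r r') l l'.
  by rewrite opE_mkop.
pose S (f : qubits k -> qubits k) :=
  \sum_l \sum_(r | e l r) opE tau (l, f l) (r, f r).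
have SE : \sum_l \sum_r opE tau (l, l) (r, r) = S id.
  apply: eq_bigr => l _; rewrite [RHS]big_mkcond; apply: eq_bigr => r _.
  by case: ifPn => // lr; rewrite blockE tau0 // /opE mxE.
have SX : S (flip j) = S id.
  by apply: eq_bigr => l _; apply: eq_bigr => r _; rewrite !blockE tauX.
have ecard l : #|[pred r | e l r]| = (2 ^ k.-1)%N.
  apply/eqP; rewrite -(eqn_pmul2l (isT : 0 < 2)%N) card_eq_bit -expnS prednK //.
  exact: leq_ltn_trans (leq0n j) (ltn_ord j).
have esym : symmetric e by move=> l r; rewrite /e eq_sym.
have Sle f := @psdmx_sum_offdiag _ _ _ _ (fun l => (l, f l)) e _ psdt esym ecard.
have half : (2 ^ k)%:R = 2 * (2 ^ k.-1)%:R :> C.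
  rewrite -natrM -expnS prednK //; exact: leq_ltn_trans (leq0n j) (ltn_ord j).
have m0 : 0 < (2 ^ k.-1)%:R :> C by rewrite ltr0n expn_gt0.
have diag_le : \sum_l opE tau (l, l) (l, l) +
    \sum_l opE tau (l, flip j l) (l, flip j l) <= \tr tau.
  rewrite mxtrace_pair -big_split /=; apply: ler_sum => l _.
  rewrite (bigD1 l) //= (bigD1 (flip j l)) /=; last first.
    by apply/eqP => /(congr1 (fun f : qubits k => f j)); rewrite flip_same; case: (l j).
  by rewrite addrA lerDl sumr_ge0 // => r _; apply: psdmx_diag.
have SS : S id + S id <= (2 ^ k.-1)%:R * \tr tau.
  rewrite -{2}SX; apply: le_trans (lerD (Sle id) (Sle (flip j))) _.
  by rewrite -mulrDr ler_wpM2l ?(ltW m0).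
rewrite /overlap SE half mulrC ler_pdivrMr; last by rewrite mulr_gt0.
rewrite [leRHS](_ : _ = (2 ^ k.-1)%:R * \tr tau / 2); last by field.
by rewrite ler_pdivlMr // mulr_natr mulr2n.
Qed.

Lemma fidelity_max_entangled tau : psdmx tau ->
  ((fidelity (@max_entangled R k) tau) ^+ 2)%:C%C = overlap tau.
Proof.
move=> psdt; pose c : C := sqrtC (2 ^ k)%:R^-1.
have c0 : 0 <= c by rewrite sqrtC_ge0 invr_ge0 ltW.
have cc : c * c = (2 ^ k)%:R^-1 by rewrite -expr2 sqrtCK.
pose h (u : qubits k * qubits k) : C := (u.1 == u.2)%:R * c.
pose v : 'rV[C]_#|{: (qubits k * qubits k)%type}| := \row_i h (enum_val i).
have hJ u : (h u)^* = h u by rewrite rmorphM /= conjC_nat geC0_conj.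
have sumh (f : qubits k * qubits k -> C) : \sum_u h u * f u = c * \sum_l f (l, l).
  rewrite (eq_bigr (fun u => h (u.1, u.2) * f (u.1, u.2))) => [|[] //].
  rewrite -(pair_bigA _ (fun l r => h (l, r) * f (l, r))) /= mulr_sumr.
  apply: eq_bigr => l _; rewrite (bigD1 l) //= big1 => [|r rl]; last first.
    by rewrite /h /= eq_sym (negPf rl) !mul0r.
  by rewrite addr0 /h eqxx mul1r.
have -> : @max_entangled R k = v ^t* *m v.
  apply: opP => u w; rewrite opE_mkop /opE mxE big_ord1 !mxE !enum_rankK /= hJ.
  by rewrite /h mulrACA cc -natrM mulnb.
rewrite fidelity_pure //; last first.
  apply/matrixP => i j; rewrite !ord1 mxE sum_enum_rank mxE eqxx mulr1n.
  under eq_bigr do rewrite !mxE enum_rankK /= hJ.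
  rewrite sumh /h (eq_bigr (fun=> c)) => [|l _]; last by rewrite eqxx mul1r.
  rewrite sumr_const card_ffun card_bool card_ord -[_ *+ _]mulr_natr mulrA cc.
  by rewrite mulVf // gt_eqF.
rewrite mxE sum_enum_rank.
under eq_bigr do (rewrite !mxE sum_enum_rank enum_rankK /= hJ mulrC; under eq_bigr do
  rewrite mxE enum_rankK).
rewrite sumh (eq_bigr (fun l => c * \sum_r opE tau (r, r) (l, l))) => [|l _]; last first.
  exact: (sumh (fun w => opE tau w (l, l))).
by rewrite -mulr_sumr mulrA cc exchange_big.
Qed.

End Overlap.

(** * Depolarizing noise as a mixture of erasures *)

Section Depolarizing.
Context {R : realType} {n : nat}.
Variable p : R.

Lemma opE_depolarizing (a b x y : bool) :
  opE (depolarizing p (delta_mx (enum_rank a) (enum_rank b))) x y =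
  p%:C%C * erasure_kernel true a b x y + (1 - p)%:C%C * erasure_kernel false a b x y.
Proof.
rewrite /depolarizing mxtrace_delta /erasure_kernel /opE !mxE !(inj_eq enum_rank_inj).
by rewrite -mulnb natrM; field.
Qed.

Lemma tensor_power_depolarizing (X : op R (qubits n)) :
  tensor_power (depolarizing p) X =
  \sum_(T : {set 'I_n}) (erasure_prob p T)%:C%C *: erase T X.
Proof.
apply: opP => x y; rewrite opE_sum opE_mkop.
under [RHS]eq_bigr do rewrite opEZ opE_mkop mulr_sumr.
rewrite [RHS]exchange_big /=; apply: eq_bigr => a _.
under [RHS]eq_bigr do rewrite mulr_sumr.
rewrite [RHS]exchange_big /=; apply: eq_bigr => b _.
under eq_bigr do rewrite opE_depolarizing.
rewrite bigA_distr mulr_sumr; apply: eq_bigr => T _.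
rewrite mulrCA; congr (_ * _); rewrite rmorph_prod /= -big_split /=.
by apply: eq_bigr => i _; case: (i \in T).
Qed.

End Depolarizing.

(** * The lower bound on the Choi error *)

Section Channels.
Context {R : realType}.
Local Notation C := R[i].

Lemma opE_sqrtmx (T : finType) (M : op R T) u v : psdmx M ->
  opE M u v = \sum_s opE (sqrtmx M) u s * (opE (sqrtmx M) v s)^*.
Proof.
move=> psdM; rewrite -{1}(sqrtmx_mul_adj psdM) opE_mul.
by apply: eq_bigr => s _; rewrite opE_adj.
Qed.

Lemma psdmx_conic (S T : finType) (c : S -> C) (M : S -> op R T) :
  (forall s, 0 <= c s) -> (forall s, psdmx (M s)) -> psdmx (\sum_s c s *: M s).
Proof.
move=> c0 psdM; apply: (@psdmx_sum_rank1 R T (S * T)%type _ (fun q => c q.1)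
  (fun q u => opE (sqrtmx (M q.1)) u q.2)) => // u v.
rewrite opE_sum -(pair_bigA _ (fun s t => c s *
  (opE (sqrtmx (M s)) u t * (opE (sqrtmx (M s)) v t)^*))) /=.
by apply: eq_bigr => s _; rewrite opEZ (opE_sqrtmx _ _ (psdM s)) mulr_sumr.
Qed.

Section Reset.
Variables (A B : finType) (b : B).

(** A decoder that discards its input; it shows that the set under the infimum in [choi_error] is
    nonempty. *)
Definition reset (X : op R A) : op R B :=
  \tr X *: delta_mx (enum_rank b) (enum_rank b).

Fact reset_linear : linear reset.
Proof.
by move=> c X Y; rewrite /reset mxtraceD mxtraceZ scalerDl scalerA.
Qed.

HB.instance Definition _ := GRing.isLinear.Build C _ _ _ reset reset_linear.

Lemma quantum_channel_reset : quantum_channel (reset : {linear op R A -> op R B}).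
Proof.
split=> [T X psdX|X]; last by rewrite mxtraceZ mxtrace_delta eqxx mulr1.
apply: (@psdmx_sum_rank1 R (B * T)%type (A * (A * T))%type _ (fun=> 1)
  (fun q u => (u.1 == b)%:R * opE (sqrtmx X) (q.1, u.2) q.2)) => // u v.
rewrite opE_ampliation opEZ opE_delta mxtrace_op.
rewrite -(pair_bigA _ (fun a s => 1 * ((u.1 == b)%:R * opE (sqrtmx X) (a, u.2) s *
  ((v.1 == b)%:R * opE (sqrtmx X) (a, v.2) s)^*))) /= mulr_suml.
apply: eq_bigr => a _; rewrite opE_mkop (opE_sqrtmx _ _ psdX) mulr_suml.
apply: eq_bigr => s _; rewrite rmorphM /= conjC_nat -mulnb natrM; ring.
Qed.

End Reset.
End Channels.

Section ChoiBound.
Context {R : realType}.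
Local Notation C := R[i].
Variables (p : R) (n k : nat) (hkn : (k <= n)%N) (U : op R (qubits n)).
Variable cone : 'I_k -> {set 'I_n}.
Hypothesis p01 : 0 < p < 1.
Hypothesis U_unitary : U \is unitarymx.
Hypothesis coneP : forall j P, commutes_off [set widen_ord hkn j] P ->
  commutes_off (cone j) (U *m P *m U ^t*).
Implicit Types (T : {set 'I_n}) (r : qubits k) (j : 'I_k).

Lemma block_noisy_state_flip T j r r' : cone j \subset T ->
  block (noisy_state hkn U T) (flip j r) (flip j r') = block (noisy_state hkn U T) r r'.
Proof.
move=> jT; rewrite !block_noisy_state; congr (_ *: _).
have cX := coneP (supported_commutes_off (supported_pauliX (R := R) (widen_ord hkn j))).
have := erase_encoding_conj U_unitary (add_ancillas hkn
  (delta_mx (enum_rank r) (enum_rank r'))) (pauliX_unitary _) cX jT.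
by rewrite -add_ancillas_pauliX.
Qed.

Lemma block_noisy_state_eq0 T j r r' : cone j \subset T -> r j != r' j ->
  block (noisy_state hkn U T) r r' = 0.
Proof.
move=> jT rr'; rewrite block_noisy_state; set E := erase T _.
suff -> : E = 0 by rewrite scaler0.
have cZ := coneP (supported_commutes_off (supported_pauliZ (R := R) (widen_ord hkn j))).
(* When the bits [j] of [r] and [r'] differ, Z conjugation changes the sign of the input, while the
   erased output cannot change. *)
have EN : E = - E.
  have := erase_encoding_conj U_unitary (add_ancillas hkn
    (delta_mx (enum_rank r) (enum_rank r'))) (pauliZ_unitary _) cZ jT.
  rewrite -add_ancillas_pauliZ // mulmxN mulNmx -scaleN1r eraseZ scaleN1r.
  by move=> EE; rewrite {1}/E /encoding -EE.
apply/matrixP => x y; have /matrixP/(_ x y) := EN.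
by rewrite [(- E) x y]mxE => /esym/eqP; rewrite eqNr => /eqP->; rewrite mxE.
Qed.

Variable J : {set 'I_k}.
Hypothesis coneJ : {in J &, forall i j, i != j -> [disjoint cone i & cone j]}.

Let survives T := all (fun j => ~~ (cone j \subset T)) (enum J).

Lemma overlap_decoded_le (Dec : {linear op R (qubits n) -> op R (qubits k)}) T :
  quantum_channel Dec ->
  overlap (ampliation Dec (noisy_state hkn U T)) <= (1 / 4 + 3 / 4 * (survives T)%:R)%:C%C.
Proof.
move=> chD; set tau := ampliation _ _.
have psdt : psdmx tau by apply: chD.1; apply: psdmx_noisy_state.
have tr1 : \tr tau <= 1 by rewrite mxtrace_channel // mxtrace_noisy_state.
have [sT|] := boolP (survives T).
  rewrite (_ : 1 / 4 + _ = 1); last by rewrite /=; field.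
  exact: le_trans (overlap_le_trace psdt) tr1.
rewrite /= mulr0n mulr0 addr0 div1r fmorphV rmorph_nat => /allPn[j _]; rewrite negbK => jT.
have /le_trans -> // : overlap tau <= \tr tau / 4.
  apply: (overlap_decoupled (j := j)) => // r r'; rewrite !(block_ampliation Dec).
    by move=> rr'; rewrite (block_noisy_state_eq0 jT rr') linear0.
  by rewrite block_noisy_state_flip.
by rewrite -[leRHS]mul1r ler_wpM2r // invr_ge0.
Qed.

Let Q := \prod_(j in J) (1 - p ^+ #|cone j|).

(** Linearity of the overlap averages the bound of [overlap_decoded_le]; [Q] is the probability that
    no chosen cone is erased. *)
Lemma fidelity_decoded_le (Dec : {linear op R (qubits n) -> op R (qubits k)}) :
  quantum_channel Dec ->
  fidelity (@max_entangled R k)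
    (ampliation (Dec \o tensor_power (depolarizing p) \o encoding hkn U)
      (@max_entangled R k)) ^+ 2 <= 1 / 4 + 3 / 4 * Q.
Proof.
move=> chD; set tau := ampliation _ _.
have tauE : tau = \sum_(T : {set 'I_n})
    (erasure_prob p T)%:C%C *: ampliation Dec (noisy_state hkn U T).
  apply: opP => u v; rewrite opE_sum opE_ampliation /= tensor_power_depolarizing.
  rewrite linear_sum opE_sum; apply: eq_bigr => T _.
  by rewrite linearZ !opEZ opE_ampliation block_ampliation.
have w0 T : 0 <= erasure_prob p T.
  by apply: erasure_prob_ge0; case/andP: p01 => /ltW-> /ltW->.
have psdt : psdmx tau.
  rewrite tauE; apply: psdmx_conic => T; first by rewrite ler0c.
  by apply: chD.1; apply: psdmx_noisy_state.
rewrite -lecR fidelity_max_entangled //.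
have -> : overlap tau = \sum_(T : {set 'I_n})
    (erasure_prob p T)%:C%C * overlap (ampliation Dec (noisy_state hkn U T)).
  rewrite /overlap; under [RHS]eq_bigr do rewrite mulrCA mulr_sumr.
  rewrite -mulr_sumr [in RHS]exchange_big /=; congr (_ * _); apply: eq_bigr => l _.
  under [RHS]eq_bigr do rewrite mulr_sumr.
  rewrite [RHS]exchange_big /=; apply: eq_bigr => r _.
  by rewrite tauE opE_sum; apply: eq_bigr => T _; rewrite opEZ.
have -> : 1 / 4 + 3 / 4 * Q =
    \sum_(T : {set 'I_n}) erasure_prob p T * (1 / 4 + 3 / 4 * (survives T)%:R).
  have QE : Q = \sum_(T : {set 'I_n}) erasure_prob p T * (survives T)%:R.
    have := @prob_erase_avoiding R n p _ cone (enum J) finset.set0 (enum_uniq J).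
    rewrite finset.cards0 expr0 mul1r big_enum /= -/Q => <-.
    - by apply: eq_bigr => T _; rewrite finset.sub0set mulr1.
    - by move=> a b; rewrite !mem_enum; exact: coneJ.
    - by move=> a _; rewrite -finset.setI_eq0 finset.set0I.
  under [RHS]eq_bigr do rewrite mulrDr.
  rewrite QE big_split /= -mulr_suml sum_erasure_prob !mul1r mulr_sumr.
  by congr (_ + _); apply: eq_bigr => T _; rewrite mulrCA.
rewrite rmorph_sum /=; apply: ler_sum => T _; rewrite rmorphM /=.
by rewrite ler_wpM2l ?ler0c // overlap_decoded_le.
Qed.

Lemma choi_error_ge :
  Num.sqrt (3 / 4 * (1 - Q)) <= choi_error hkn U (tensor_power (depolarizing p)).
Proof.
apply: lb_le_inf.
  pose b : qubits k := [ffun=> false].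
  exists (purified_distance (@max_entangled R k)
    (ampliation ((reset b : {linear op R (qubits n) -> op R (qubits k)}) \o
      tensor_power (depolarizing p) \o encoding hkn U) (@max_entangled R k))).
  by exists (reset b : {linear op R (qubits n) -> op R (qubits k)}) => //;
    exact: quantum_channel_reset.
move=> _ [Dec chD ->]; rewrite /purified_distance; apply: ler_wsqrtr.
by have := fidelity_decoded_le chD; lra.
Qed.

End ChoiBound.

Lemma choi_error_bound (R : realType) (p : R) (n k L : nat) (hkn : (k <= n)%N)
    (U : op R (qubits n)) (cone : 'I_k -> {set 'I_n}) :
  0 < p < 1 -> U \is unitarymx -> (0 < k)%N ->
  (forall j P, commutes_off [set widen_ord hkn j] P ->
     commutes_off (cone j) (U *m P *m U ^t*)) ->
  (forall j, widen_ord hkn j \in cone j) ->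
  (forall j, (#|cone j| <= L)%N) ->
  (forall i, (#|[set j | i \in cone j]| <= L)%N) ->
  let eps := choi_error hkn U (tensor_power (depolarizing p)) in
  eps < 1 / 10 ->
  0 < eps /\ 3 * k%:R * p ^+ L <= 8 * eps ^+ 2 * L%:R ^+ 2.
Proof.
move=> p01 Uu k0 coneP cone_self coneL coneL' eps eps_lt.
have [p0 p1] := andP p01.
(* Conflict graph of the logical qubits; an independent set in it has pairwise disjoint cones. *)
pose e j j' := ~~ [disjoint cone j & cone j'].
have er : reflexive e.
  move=> j; rewrite /e -finset.setI_eq0 finset.setIid.
  by apply/finset.set0Pn; exists (widen_ord hkn j).
have es : symmetric e by move=> j j'; rewrite /e disjoint_sym.
have eL j : (#|[set j' | e j j']| <= L * L)%N.
  apply: (@leq_trans (#|cone j| * L)); last by rewrite leq_mul2r coneL orbT.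
  apply: leq_trans (leq_card_bigcup (F := fun i => [set j' | i \in cone j']) _) => //.
  apply: subset_leq_card; apply/fintype.subsetP => j'.
  rewrite inE /e -finset.setI_eq0 => /finset.set0Pn-[i ].
  by rewrite inE => /andP[ij ij']; apply/finset.bigcupP; exists i; rewrite ?inE.
have [J indJ] := exists_independent er es eL; rewrite card_ord => kJ.
have coneJ : {in J &, forall i j, i != j -> [disjoint cone i & cone j]}.
  by move=> i j iJ jJ; apply: contraNT => ij; apply/eqP/indJ.
have := choi_error_ge p01 Uu coneP coneJ; rewrite -/eps.
have := prod_surv_le J p01 coneL.
set Q := \prod_(j in J) _; set y := _ * p ^+ L => Qy Qeps.
have J0 : (0 < #|J|)%N.
  by have := leq_trans k0 kJ; rewrite muln_gt0 => /andP[].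
have pL0 : 0 < p ^+ L by rewrite exprn_gt0.
have y0 : 0 < y by rewrite mulr_gt0 // ltr0n.
have Q1 : Q * (1 + y) <= 1.
  by rewrite -ler_pdivlMr ?div1r //; lra.
have Q0 : 0 < 3 / 4 * (1 - Q) by nra.
have eps0 : 0 < eps by rewrite (lt_le_trans _ Qeps) // sqrtr_gt0.
split=> //; have eps2 : 3 / 4 * (1 - Q) <= eps ^+ 2.
  by rewrite -[leLHS]sqr_sqrtr ?(ltW Q0) // lerXn2r // ?nnegrE ?sqrtr_ge0 // ltW.
have eps2lt : eps ^+ 2 <= 1 / 100.
  have : eps ^+ 2 <= (1 / 10) ^+ 2 by rewrite lerXn2r // ?nnegrE ltW.
  by lra.
(* From Q (1 + y) <= 1 one gets 3 y <= 4 eps^2 (1 + y). With eps^2 <= 1/100 this forces y < 1, so 1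
   + y is at most 2. *)
have ye : 3 * y <= 8 * eps ^+ 2 by nra.
have kJR : k%:R <= #|J|%:R * L%:R ^+ 2 :> R.
  by rewrite -natrX -natrM ler_nat expnS expn1.
apply: (@le_trans _ _ (3 * y * L%:R ^+ 2)).
  rewrite /y; have := ler_wpM2r (ltW pL0) kJR; lra.
by rewrite ler_wpM2r // exprn_ge0.
Qed.

(** The cone bound is assumed for every circuit of the same depth because it is applied both to [c]
    and to [rev c]. *)
Lemma circuit_choi_error_bound (R : realType) (p : R) (n k L : nat) (hkn : (k <= n)%N)
    (E : rel 'I_n) (c : seq (seq (@gate R n))) :
  0 < p < 1 -> (0 < k)%N -> all (is_layer E) c ->
  (forall (c' : seq (seq (@gate R n))) j, all (is_layer E) c' -> size c' = size c ->
     (#|[set i | reach c' i j]| <= L)%N) ->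
  let eps := choi_error hkn (circuit_mx c) (tensor_power (depolarizing p)) in
  eps < 1 / 10 ->
  0 < eps /\ 3 * k%:R * p ^+ L <= 8 * eps ^+ 2 * L%:R ^+ 2.
Proof.
move=> p01 k0 layers reachL.
apply: (@choi_error_bound _ _ _ _ _ _ _
  (fun j => [set i | reach c i (widen_ord hkn j)])) => //.
- exact: circuit_mx_unitary layers.
- by move=> j P; apply: commutes_off_circuit layers.
- by move=> j; rewrite inE reach_refl.
- by move=> j; apply: reachL.
move=> i; have inj_widen : injective (widen_ord hkn) by move=> a b [] /val_inj.
rewrite -(finset.card_imset _ inj_widen).
(* The logical qubits whose forward cone contains [i] embed into the cone of [i] in the reversed
   circuit. *)
apply: leq_trans (reachL (rev c) i _ _); rewrite ?all_rev ?size_rev //.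
apply: subset_leq_card; apply/fintype.subsetP => m /finset.imsetP[j].
by rewrite !inE reach_rev => ij ->.
Qed.

(** * The depth bounds *)

Local Open Scope classical_set_scope.
Local Open Scope ring_scope.

Theorem theorem4 (R : realType) (p : R) (p_gt0 : 0 < p) (p_lt1 : p < 1) :
  (forall D : nat, (0 < D)%N ->
     exists o : nat -> R,
     [/\ o @ \oo --> (0 : R), (forall d, -1 < o d) &
       forall (n k d : nat) (hkn : (k <= n)%N) (U : op R (qubits n)),
         (0 < k)%N -> (0 < d)%N -> lattice_circuit D d U ->
         let eps := choi_error hkn U (tensor_power (depolarizing p)) in
         eps < 1 / 10 ->
         [/\ 0 < eps,
             log2 (3 / (8 * eps ^+ 2)) + log2 k%:R
               <= (2 * d)%:R ^+ D * log2 (1 / p)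
                  + (2 * D)%:R * log2 (2 * d)%:R &
             1 / 2 * ((log2 (3 / (8 * eps ^+ 2)) + log2 k%:R)
                       / ((1 + o d) * log2 (1 / p))) `^ (1 / D%:R)
               <= d%:R]])
  /\
  (exists o : nat -> R,
     [/\ o @ \oo --> (0 : R), (forall d, -1 < o d) &
       forall (n k d : nat) (hkn : (k <= n)%N) (U : op R (qubits n)),
         (0 < k)%N -> all_to_all_circuit d U ->
         let eps := choi_error hkn U (tensor_power (depolarizing p)) in
         eps < 1 / 10 ->
         [/\ 0 < eps,
             log2 (3 / (8 * eps ^+ 2)) + log2 k%:R
               <= 2 ^+ d * log2 (1 / p) + (2 * d)%:R &
             log2 ((log2 (3 / (8 * eps ^+ 2)) + log2 k%:R)
                    / ((1 + o d) * log2 (1 / p)))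
               <= d%:R]]).
Proof.
have p01 : 0 < p < 1 by rewrite p_gt0.
have b0 : 0 < log2 (1 / p) by exact/log2_gt0/inv_gt1.
have o_gt d : -1 < log_correction p d.
  by apply: lt_le_trans (log_correction_ge0 p01 d); rewrite ltrN10.
have den0 d : 0 < (1 + log_correction p d) * log2 (1 / p).
  by rewrite mulr_gt0 // -ltrBlDl sub0r.
split=> [D D0|]; exists (log_correction p); split => //;
  try exact: log_correction_cvg.
  move=> n k d hkn _ k0 d0 [pos injpos [c [sc lc ->]]] eps eps1.
  have dd0 : (0 < 2 * d)%N by rewrite muln_gt0.
  have [] := @circuit_choi_error_bound _ p n k ((2 * d) ^ D)%N hkn _ c p01 k0 lc _ eps1.
    move=> c' j lc' sc'; rewrite -sc -sc'.
    by apply: card_reach_lattice injpos _ lc'; rewrite sc' sc.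
  rewrite -/eps => eps0 /(log2_bound p01 eps0 k0); rewrite expn_gt0 dd0 => /(_ isT) HX.
  (* Taking D-th roots below is monotone on nonnegative reals, so the numerator must be nonnegative;
     eps < 1/10 ensures it. *)
  have log_arg0 := log2_inv_error_ge0 eps0 eps1 k0.
  split=> //.
    move: HX; rewrite natrX log2X ?ltr0n // mulrA -natrM; exact.
  have dL : (d <= (2 * d) ^ D)%N.
    apply: (@leq_trans (2 * d)); first by rewrite leq_pmull.
    by rewrite -{1}(expn1 (2 * d)) leq_pexp2l.
  have L0 : (0 < (2 * d) ^ D)%N by rewrite expn_gt0 dd0.
  have dN0 : d = 0%N -> ((2 * d) ^ D)%N = 1%N by move=> dz; rewrite dz in d0.
  have HY := log2_asymptotic p01 dL L0 dN0 HX.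
  have D1 : D%:R != 0 :> R by rewrite pnatr_eq0 -lt0n.
  have rootE : ((2 * d) ^ D)%N%:R `^ (1 / D%:R) = (2 * d)%:R :> R.
    by rewrite natrX -powR_mulrn ?ler0n // -powRrM div1r mulfV // powRr1 ?ler0n.
  have : ((log2 (3 / (8 * eps ^+ 2)) + log2 k%:R) /
      ((1 + log_correction p d) * log2 (1 / p))) `^ (1 / D%:R) <= (2 * d)%:R.
    by rewrite -rootE; apply: ge0_ler_powR;
      rewrite ?nnegrE ?divr_ge0 ?ler0n ?(ltW (den0 d)).
  by rewrite natrM; lra.
move=> n k d hkn _ k0 [c [sc lc ->]] eps eps1.
have [] := @circuit_choi_error_bound _ p n k (2 ^ d)%N hkn _ c p01 k0 lc _ eps1.
  by move=> c' j lc' sc'; rewrite -sc -sc'; exact: card_reach_all_to_all.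
rewrite -/eps => eps0 /(log2_bound p01 eps0 k0); rewrite expn_gt0 => /(_ isT) HX.
split=> //.
  by move: HX; rewrite log2_exp natrX -natrM.
have dL : (d <= 2 ^ d)%N by rewrite ltnW // ltn_expl.
have L0 : (0 < 2 ^ d)%N by rewrite expn_gt0.
(* Depth 0 is allowed here, and its cones are single qubits. *)
have d0 : d = 0%N -> (2 ^ d)%N = 1%N by move=> ->.
exact/log2_le_exp/(log2_asymptotic p01 dL L0 d0 HX).
Qed.
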